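(* Let $(M,\mathbf p)$ be a connected $n$-dimensional projective manifold, $n\ge 2$, with tractor bundle $\mathcal T$ and projective Thomas operator $D_A$. For $k\ge 0$ and a weight $\omega$ let $\mathcal E_{[A_1\dots A_k]}(\omega)$ denote the sections of $(\Lambda^k\mathcal T^* )(\omega)$, and define $\mathscr D$ on $F\in\mathcal E_{[A_1\dots A_k]}(\omega)$ by $$(\mathscr DF)_{A_1\dots A_{k+1}}=(k+1)\,D_{[A_1}F_{A_2\cdots A_{k+1}]}.$$ Then $$\cdots\longrightarrow\mathcal E_{[A_1\dots A_k]}(\omega)\overset{\mathscr D}{\longrightarrow}\mathcal E_{[A_1\dots A_{k+1}]}(\omega-1)\overset{\mathscr D}{\longrightarrow}\mathcal E_{[A_1\dots A_{k+2}]}(\omega-2)\longrightarrow\cdots$$ is a co-chain complex, i.e. $\mathscr D^2=0$. Furthermore, if $\nabla\in\mathbf p$, $k\geq 1$ and $F\overset{\nabla}{=}\begin{pmatrix}\mu_{a_2\cdots a_k}\\ \xi_{a_1\cdots a_k}\end{pmatrix}$, then $$\mathscr DF\overset{\nabla}{=}\begin{pmatrix}(\omega+k)\,\xi_{a_2\cdots a_{k+1}}-k\nabla_{[a_2}\mu_{a_3\cdots a_{k+1}]}\\[2pt] (k+1)\nabla_{[a_1}\xi_{a_2\cdots a_{k+1}]}+\frac{(k+1)!}{(k-1)!}P_{[a_1a_2}\mu_{a_3\cdots a_{k+1}]}\end{pmatrix}.$$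
   Context: Abstract index notation; square brackets denote antisymmetrisation (with factor $1/k!$). A projective structure $\mathbf p$ on an $n$-manifold $M$ is a class of torsion-free affine connections on $TM$ related by $\hat\nabla=\nabla+\Upsilon$, meaning $\hat\nabla_a\xi^b=\nabla_a\xi^b+\Upsilon_c\xi^c\delta_a^b+\Upsilon_a\xi^b$ for a one-form $\Upsilon_a$. The density bundle $\mathcal E(\omega)$ is the real line bundle associated to the frame bundle via $A\mapsto|\det A|^{\omega/(n+1)}$; $\mathcal B(\omega)=\mathcal B\otimes\mathcal E(\omega)$. Curvature: $2\nabla_{[a}\nabla_{b]}X^c=R_{ab}{}^c{}_dX^d$, $R_{ab}=R_{ca}{}^c{}_b$, $\beta_{ab}=-\frac{2}{n+1}R_{[ab]}$, and the projective Schouten tensor $P_{ab}$ of $\nabla$ is given by $(n-1)P_{ab}=R_{ab}+\beta_{ab}$. Tractor bundle $\mathcal T$ (rank $n+1$): each $\nabla\in\mathbf p$ gives an isomorphism $\mathcal T\cong TM(-1)\oplus\mathcal E(-1)$, $T^A\overset{\nabla}{=}\nu^aW^A_a+\rho X^A$; under $\hat\nabla=\nabla+\Upsilon$, $\hat\nu^a=\nu^a$, $\hat\rho=\rho-\Upsilon_b\nu^b$. The dual splitting has $Y_A,Z_A^a$ with $X^AY_A=1$, $Z_A^aW^A_b=\delta^a_b$, $Z^a_AX^A=0$, $W^A_aY_A=0$ ($X^A$ has weight $1$ and $Z^a_A$ weight $-1$; they are canonical, while $Y_A,W^A_a$ depend on $\nabla$). The tractor connection, coupled with $\nabla$, is determined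 by $\nabla_aY_A=P_{ab}Z_A^b$, $\nabla_aZ_A^b=-\delta_a^bY_A$, $\nabla_aX^A=W^A_a$, $\nabla_aW^A_c=-P_{ac}X^A$. Thomas operator: on a weighted tractor $F$ of weight $\omega$ (with any tractor indices), $D_AF\overset{\nabla}{=}\omega Y_AF+Z^a_A\nabla_aF$; this is independent of $\nabla\in\mathbf p$ and has weight $\omega-1$. Column notation: for $F\in\Gamma((\Lambda^k\mathcal T^* )(\omega))$, $k\ge1$, $F\overset{\nabla}{=}\begin{pmatrix}\mu\\ \xi\end{pmatrix}$ means $F_{A_1\dots A_k}=k\,\mu_{a_2\dots a_k}Y_{[A_1}Z^{a_2}_{A_2}\cdots Z^{a_k}_{A_k]}+\xi_{a_1\dots a_k}Z^{a_1}_{A_1}\cdots Z^{a_k}_{A_k}$ with $\mu\in\Gamma((\Lambda^{k-1}T^*M)(k+\omega))$ and $\xi\in\Gamma((\Lambda^kT^*M)(k+\omega))$ (the second component vanishes if $k=n+1$). *)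

(* Defs.v *)
(** Projective tractor calculus on smooth manifolds, in the MathComp /
    MathComp-Analysis libraries, over an arbitrary [R : realType].

    Sections of natural bundles are given by their components: one array of
    functions for every chart of the atlas (for tractors: for every chart and
    every connection of the projective class), obeying the transition laws
    below.  Components are functions of the coordinates ['rV[R]_n], meaningful
    only on the image of the chart, and equality of sections is equality of
    components there. *)
From HB Require Import structures.
From mathcomp Require Import all_boot all_order all_algebra all_fingroup.
From mathcomp Require Import all_classical all_reals all_analysis.

Set Implicit Arguments.
Unset Strict Implicit.
Unset Printing Implicit Defensive.

Import Order.TTheory GRing.Theory Num.Theory.
Import numFieldNormedType.Exports.

Local Open Scope classical_set_scope.
Local Open Scope ring_scope.

(** * Smooth functions on open sets of R^n *)

Section Smooth.
Variables (R : realType) (n : nat).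
Implicit Types (f : 'rV[R]_n -> R) (x : 'rV[R]_n) (O : set 'rV[R]_n).

Definition pd (i : 'I_n) f : 'rV[R]_n -> R := fun x => 'D_(delta_mx ord0 i) f x.

Definition iter_pd (s : seq 'I_n) f : 'rV[R]_n -> R := foldr pd f s.

(** Requiring every iterated partial derivative to be (Frechet) differentiable
    is equivalent, on an open set, to C^infinity: it forces all of them to be
    continuous, and conversely C^1 functions are differentiable. *)
Definition smooth_on O f : Prop :=
  forall s x, O x -> differentiable (iter_pd s f) x.

End Smooth.

(** * Smooth manifolds *)

Record smooth_manifold (R : realType) (n : nat) := SmoothManifold {
  mfd_space :> topologicalType;
  mfd_hausdorff : hausdorff_space mfd_space;
  mfd_second_countable : @second_countable mfd_space;
  atlas : Type;
  dom : atlas -> set mfd_space;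
  coord : atlas -> mfd_space -> 'rV[R]_n;
  param : atlas -> 'rV[R]_n -> mfd_space;
  dom_open : forall c, open (dom c);
  dom_cover : forall m, exists c, dom c m;
  coord_open : forall c, open (coord c @` dom c);
  coordK : forall c m, dom c m -> param c (coord c m) = m;
  coord_continuous : forall c, {within dom c, continuous (coord c)};
  param_continuous : forall c, {within coord c @` dom c, continuous (param c)};
  transition_smooth : forall c c' (j : 'I_n),
    smooth_on (coord c @` (dom c `&` dom c'))
              (fun x => coord c' (param c x) ord0 j)
}.

(** * Covariant tensors over a d-dimensional vector space, in a frame *)

Section Cotensors.
Variables (R : realType) (d : nat).

Definition cotensor (k : nat) := {ffun 'I_k -> 'I_d} -> R.

(** [(A^* T)(e_I) = T(A e_I1, ..., A e_Ik)]. *)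
Definition pull k (A : 'M[R]_d) (T : cotensor k) : cotensor k :=
  fun I => \sum_(K : {ffun 'I_k -> 'I_d}) (\prod_(i < k) A (K i) (I i)) * T K.

Definition skew k (T : cotensor k) : Prop :=
  forall (s : 'S_k) (I : {ffun 'I_k -> 'I_d}), T [ffun i => I (s i)] = (-1) ^+ s * T I.

(** Square brackets: [T_[a1...ak]]. *)
Definition alt k (T : cotensor k) : cotensor k := fun I =>
  (k`!%:R)^-1 * \sum_(s : 'S_k) (-1) ^+ s * T [ffun i => I (s i)].

(** [T_(a1 a2...ak.+1) = (V_a1)_(a2...ak.+1)]. *)
Definition front k (V : 'I_d -> cotensor k) : cotensor k.+1 := fun I =>
  V (I ord0) [ffun i => I (lift ord0 i)].

Definition subst_index k (I : {ffun 'I_k -> 'I_d}) (i : 'I_k) (e : 'I_d) :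
  {ffun 'I_k -> 'I_d} := [ffun j => if j == i then e else I j].

End Cotensors.

Section Connections.
Variables (R : realType) (n : nat).

(** Covariant derivative of a covariant tensor of weight [w] over a rank [d]
    bundle whose connection is [nabla_a e_i = \sum_l (A a)_l,i e_l] in the chosen
    frame; [th a] is the connection form of the density bundle of weight 1. *)
Definition cov d k (A : 'I_n -> 'rV[R]_n -> 'M[R]_d) (th : 'I_n -> 'rV[R]_n -> R)
    (w : R) (T : 'rV[R]_n -> cotensor R d k) (a : 'I_n) (x : 'rV[R]_n) :
    cotensor R d k := fun I =>
  pd a (fun y => T y I) x + w * th a x * T x I
  - \sum_(i < k) \sum_(e < d) A a x e (I i) * T x (subst_index I i e).

(** From here on an affine connection is given in a chart by its Christoffel
    matrices, [(G a)_b,e = G_(a e)^b] and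
    [nabla_a xi^b = pd_a xi^b + G_(a e)^b xi^e]. *)
Variable G : 'I_n -> 'rV[R]_n -> 'M[R]_n.

Definition vcov (xi : 'rV[R]_n -> 'I_n -> R) (a b : 'I_n) (x : 'rV[R]_n) : R :=
  pd a (fun y => xi y b) x + \sum_(e < n) G a x b e * xi x e.

(** [nabla_a nabla_b xi^c]. *)
Definition vcov2 (xi : 'rV[R]_n -> 'I_n -> R) (a b c : 'I_n) (x : 'rV[R]_n) : R :=
  pd a (vcov xi b c) x - \sum_(e < n) G a x e b * vcov xi e c x
  + \sum_(e < n) G a x c e * vcov xi b e x.

(** [R_ab^c_d], read off from [2 nabla_[a nabla_b] X^c = R_ab^c_d X^d] on the
    coordinate vector field [X = pd_d]. *)
Definition curvature (a b c d : 'I_n) (x : 'rV[R]_n) : R :=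
  let X := fun (_ : 'rV[R]_n) (e : 'I_n) => (e == d)%:R in
  vcov2 X a b c x - vcov2 X b a c x.

Definition ricci (a b : 'I_n) (x : 'rV[R]_n) : R :=
  \sum_(c < n) curvature c a c b x.

Definition beta (a b : 'I_n) (x : 'rV[R]_n) : R :=
  - (2 / n.+1%:R) * ((ricci a b x - ricci b a x) / 2).

Definition schouten (a b : 'I_n) (x : 'rV[R]_n) : R :=
  (ricci a b x + beta a b x) / n.-1%:R.

(** The weight [n+1] densities are the volume multivectors, [|/\^n TM|], so that
    [nabla_a s = pd_a s + w / (n+1) G_(a b)^b s] on [E(w)]. *)
Definition weight_form (a : 'I_n) (x : 'rV[R]_n) : R := \tr (G a x) / n.+1%:R.

(** The tractor bundle is trivialised by [X^A] (index [ord0]) and [W^A_b] (index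
    [lift ord0 b]), the weights being trivialised by the chart.  The columns are
    [nabla_a X = W_a] and [nabla_a W_c = - P_ac X]; the other terms come from the
    coupling with [nabla], as the components of a tractor are a function
    [rho] and a vector [nu], both of weight -1. *)
Definition tractor_conn_matrix (a : 'I_n) (x : 'rV[R]_n) : 'M[R]_n.+1 :=
  block_mx (- weight_form a x)%:M        (\row_(c < n) - schouten a c x)
           (\col_(b < n) (b == a)%:R)    (G a x - (weight_form a x)%:M).

End Connections.

(** * Weighted forms, affine connections and projective structures *)

Section Manifold.
Variables (R : realType) (n : nat) (M : smooth_manifold R n).

Definition chart_image (c : atlas M) : set 'rV[R]_n := coord c @` dom c.

Definition overlap (c c' : atlas M) : set 'rV[R]_n :=
  coord c @` (dom c `&` dom c').

Definition transition (c c' : atlas M) (x : 'rV[R]_n) : 'rV[R]_n :=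
  coord c' (param c x).

(** [jac_(k, i) = pd_i (x'^k)]; it maps components of vectors in the chart [c]
    to components in [c']. *)
Definition jac (c c' : atlas M) (x : 'rV[R]_n) : 'M[R]_n :=
  \matrix_(k < n, i < n) pd i (fun y => transition c c' y ord0 k) x.

(** [E(w)] is associated to the frame bundle via [|det A|^(w/(n+1))]: if [s] and
    [s'] are the components of a section in [c] and [c'], then
    [s' = density_factor w (jac c c') * s]. *)
Definition density_factor (w : R) (J : 'M[R]_n) : R :=
  `|\det J| `^ (w / n.+1%:R).

Definition form_field (d k : nat) := atlas M -> 'rV[R]_n -> cotensor R d k.

(** Sections of [(/\^k T^*M)(w)]. *)
Definition weighted_form (k : nat) (w : R) (xi : form_field n k) : Prop :=
  [/\ forall c I, smooth_on (chart_image c) (fun x => xi c x I),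
      forall c x, chart_image c x -> skew (xi c x)
    & forall c c' x, overlap c c' x -> forall I,
        xi c x I = density_factor (- w) (jac c c' x)
                   * pull (jac c c' x) (xi c' (transition c c' x)) I].

Record connection := Connection {
  christoffel :> atlas M -> 'I_n -> 'rV[R]_n -> 'M[R]_n;
  christoffel_smooth : forall c a b e,
    smooth_on (chart_image c) (fun x => christoffel c a x b e);
  torsion_free : forall c x, chart_image c x -> forall a b e,
    christoffel c a x b e = christoffel c e x b a;
  christoffel_transition : forall c c' x, overlap c c' x -> forall i j l,
    \sum_(k < n) jac c c' x l k * christoffel c i x k j =
    pd i (pd j (fun y => transition c c' y ord0 l)) x +
    \sum_(i' < n) \sum_(j' < n)
      christoffel c' i' (transition c c' x) l j' * jac c c' x i' i * jac c c' x j' j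
}.

(** [nabla' = nabla + Upsilon]. *)
Definition projective_change (nab nab' : connection) (U : form_field n 1) : Prop :=
  weighted_form 0 U /\
  forall c (xi : 'rV[R]_n -> 'I_n -> R),
    (forall b, smooth_on (chart_image c) (fun x => xi x b)) ->
    forall x, chart_image c x -> forall a b : 'I_n,
      vcov (nab' c) xi a b x =
      vcov (nab c) xi a b x
      + (\sum_(e < n) U c x [ffun=> e] * xi x e) * (a == b)%:R
      + U c x [ffun=> a] * xi x b.

Definition projective_structure (p : set connection) : Prop :=
  exists nab, p = [set nab' | exists U, projective_change nab nab' U].

(** * Tractors *)

(** Components of covariant tractors in the splitting given by a connection and
    the frame given by a chart: the index [ord0] stands for the factor [Y_A] and
    [lift ord0 a] for [Z_A^a]. *)
Definition tractor_field (k : nat) := connection -> form_field n.+1 k.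

(** The tractor bundle: the maps [(rho, nu) |-> (rho', nu')] between components
    of a tractor, for a change of chart (both components have weight -1) and for
    [nabla' = nabla + Upsilon], where [nu' = nu] and [rho' = rho - U_b nu^b]. *)
Definition tractor_transition (J : 'M[R]_n) : 'M[R]_n.+1 :=
  density_factor (- 1) J *: (lift0_mx J : 'M[R]_(1 + n)).

Definition splitting_change (v : 'I_n -> R) : 'M[R]_n.+1 :=
  block_mx (1%:M : 'M[R]_1) (\row_(b < n) - v b) 0 1%:M.

(** Tractor [k]-forms of weight [w] for the projective structure [p]; tractor
    cotensors are dual to the above. *)
Definition tractor_form (p : set connection) (k : nat) (w : R)
    (F : tractor_field k) : Prop :=
  [/\ forall nab, p nab -> forall c I,
        smooth_on (chart_image c) (fun x => F nab c x I),
      forall nab, p nab -> forall c x, chart_image c x -> skew (F nab c x),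
      forall nab, p nab -> forall c c' x, overlap c c' x -> forall I,
        F nab c x I =
        density_factor (- w) (jac c c' x)
        * pull (tractor_transition (jac c c' x))
               (F nab c' (transition c c' x)) I
    & forall nab nab' U, p nab -> p nab' -> projective_change nab nab' U ->
        forall c x, chart_image c x -> forall I,
        F nab c x I =
        pull (splitting_change (fun b => U c x [ffun=> b])) (F nab' c x) I].

Definition tY (A : 'I_n.+1) : R := (A == ord0)%:R.

Definition tZ (a : 'I_n) (A : 'I_n.+1) : R := (A == lift ord0 a)%:R.

Definition tractor_cov k (w : R) (F : tractor_field k) (nab : connection)
    (c : atlas M) (a : 'I_n) (x : 'rV[R]_n) : cotensor R n.+1 k :=
  cov (tractor_conn_matrix (nab c)) (weight_form (nab c)) w (F nab c) a x.

(** [D_A F = w Y_A F + Z_A^a nabla_a F]. *)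
Definition thomas k (w : R) (F : tractor_field k) : tractor_field k.+1 :=
  fun nab c x => front (fun A I =>
    w * tY A * F nab c x I + \sum_(a < n) tZ a A * tractor_cov w F nab c a x I).

Definition scrD k (w : R) (F : tractor_field k) : tractor_field k.+1 :=
  fun nab c x I => k.+1%:R * alt (thomas w F nab c x) I.

(** The tractor form
    [(k+1) mu_(a1...ak) Y_[A0 Z_A1^a1 ... Z_Ak]^ak + xi_(a0...ak) Z_A0^a0 ... Z_Ak^ak]. *)
Definition column k (mu : cotensor R n k) (xi : cotensor R n k.+1) :
    cotensor R n.+1 k.+1 := fun A =>
  k.+1%:R * alt (front (fun A0 A' =>
      \sum_(a : {ffun 'I_k -> 'I_n}) mu a * tY A0 * \prod_(i < k) tZ (a i) (A' i))) A
  + \sum_(a : {ffun 'I_k.+1 -> 'I_n}) xi a * \prod_(i < k.+1) tZ (a i) (A i).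

(** [F = (mu ; xi)] in the splitting determined by [nab], where [F] is a tractor
    [k.+1]-form of weight [w]. *)
Definition splits_as (nab : connection) k (w : R) (F : tractor_field k.+1)
    (mu : form_field n k) (xi : form_field n k.+1) : Prop :=
  [/\ weighted_form (k.+1%:R + w) mu,
      weighted_form (k.+1%:R + w) xi
    & forall c x, chart_image c x -> forall A,
        F nab c x A = column (mu c x) (xi c x) A].

(** [nabla_[a1 xi_(a2...)]], for [xi] of weight [w]. *)
Definition alt_nabla (nab : connection) k (w : R) (xi : form_field n k) :
    form_field n k.+1 := fun c x =>
  alt (front (fun a => cov (nab c) (weight_form (nab c)) w (xi c) a x)).

(** [P_[a1a2 mu_(a3...)]]. *)
Definition alt_schouten (nab : connection) k (mu : form_field n k) :
    form_field n k.+2 := fun c x =>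
  alt (front (fun a => front (fun b I => schouten (nab c) a b x * mu c x I))).

End Manifold.

(* Main.v *)
(** Idea.  Sections of [E(w)] are the functions of homogeneity degree [w] on a cone
    over [M], and tractor [k]-forms of weight [w] are the homogeneous [k]-forms on
    that cone; [scrD] is its exterior derivative, so that [scrD (scrD F) = 0].
    Concretely, over a chart, pass to the splitting in which the connection form of
    the densities vanishes ([volume_frame]).  In the coframe [(ds, dx)] the operator
    becomes the alternation of "multiply by [w + k]" in the direction [ds] and of
    the partial derivatives in the directions [dx] ([scrD_cone_ext]).  All the
    connection terms are symmetric in the derivative index and the index they
    contract, hence die under alternation; for the Schouten tensor this needs
    [P_ab - P_ba = - (pd_a th_b - pd_b th_a)], with [th] the connection form of the
    densities, which follows from the Bianchi identity.  The resulting expression no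
    longer mentions the connection, whence projective invariance, and it is natural
    under changes of charts, whose effect on the cone is the map
    [(s, x) |-> (s |det J|^(-1/(n+1)), x')].  The column formula is the expansion of
    the alternation over the position of the derivative index. *)
Require Import Defs.
From mathcomp Require Import all_boot all_order all_algebra all_fingroup.
From mathcomp Require Import all_classical all_reals all_analysis.
From mathcomp Require Import ring.

Set Implicit Arguments.
Unset Strict Implicit.
Unset Printing Implicit Defensive.

Import Order.TTheory GRing.Theory Num.Theory.
Import numFieldNormedType.Exports.

Local Open Scope classical_set_scope.
Local Open Scope ring_scope.

(** Each covariant tractor slot scales like one unit of weight, so a form of weight [w] and rank [k]
    has homogeneity [w + k]. Since [scrD] lowers [w] by one and raises [k] by one, both steps of the
    complex are the same operator [cone_ext m]. The matrix [volume_frame] is unipotent, hence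
    invertible, so tractor components may be compared after pulling back along it. It varies with
    the point, and its derivative supplies exactly the term that the antisymmetric part of the
    Schouten tensor has to cancel. The number [n + 1] occurs in the weight of a density, in [beta]
    and in the trace of a projective change; these occurrences match, so that this antisymmetric
    part is minus the curl of [th] with coefficient one, and [th] shifts by exactly [U]. Equalities
    of sections hold only on chart images, so an identity that is to be differentiated has to be
    known on a neighbourhood of the point. *)

(** * Index tuples with a distinguished front index *)

Section Cons.
Variables (T : finType) (k : nat).
Implicit Types (a : T) (J : {ffun 'I_k -> T}).

Definition fcons a J : {ffun 'I_k.+1 -> T} :=
  [ffun i => if unlift ord0 i is Some j then J j else a].

Definition ftail (I : {ffun 'I_k.+1 -> T}) : {ffun 'I_k -> T} :=
  [ffun i => I (lift ord0 i)].

Lemma fcons0 a J : fcons a J ord0 = a.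
Proof. by rewrite ffunE unlift_none. Qed.

Lemma fconsS a J i : fcons a J (lift ord0 i) = J i.
Proof. by rewrite ffunE liftK. Qed.

Lemma ftail_fcons a J : ftail (fcons a J) = J.
Proof. by apply/ffunP => i; rewrite ffunE fconsS. Qed.

Lemma fcons_eta (I : {ffun 'I_k.+1 -> T}) : fcons (I ord0) (ftail I) = I.
Proof. by apply/ffunP => i; case: (unliftP ord0 i) => [j|] ->; rewrite ?fcons0// fconsS ffunE. Qed.

Lemma big_fcons (R : nmodType) (f : {ffun 'I_k.+1 -> T} -> R) :
  \sum_(K : {ffun 'I_k.+1 -> T}) f K = \sum_a \sum_J f (fcons a J).
Proof.
rewrite pair_bigA (reindex (fun p : T * {ffun 'I_k -> T} => fcons p.1 p.2))//=.
exists (fun K : {ffun 'I_k.+1 -> T} => (K ord0, ftail K)) => [[a J] _|K _] /=.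
  by rewrite fcons0 ftail_fcons.
exact: fcons_eta.
Qed.

End Cons.

(** * Alternation *)

Section Alternation.
Variables (R : realType) (d : nat).
Local Notation index k := {ffun 'I_k -> 'I_d}.

Lemma skew_alt k (T : cotensor R d k) : Defs.skew (alt T).
Proof.
move=> s I; rewrite /alt mulrCA; congr (_ * _).
rewrite (reindex_inj (mulIg s^-1%g)) /= big_distrr /=.
apply: eq_bigr => t _; rewrite mulrA -signr_addb odd_permM odd_permV addbC.
by congr (_ * T _); apply/ffunP => i; rewrite !ffunE permM permKV.
Qed.

Lemma alt_perm k (s : 'S_k) (T : cotensor R d k) I :
  alt (fun I : index k => T [ffun i => I (s i)]) I = (-1) ^+ s * alt T I.
Proof.
rewrite /alt mulrCA; congr (_ * _).
rewrite (reindex_inj (mulgI s^-1%g)) /= big_distrr /=.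
apply: eq_bigr => t _; rewrite mulrA -signr_addb odd_permM odd_permV.
by congr (_ * T _); apply/ffunP => i; rewrite !ffunE permM permK.
Qed.

Lemma eq_alt k (T T' : cotensor R d k) : T =1 T' -> alt T =1 alt T'.
Proof. by move=> e I; rewrite /alt; under eq_bigr do rewrite e. Qed.

(** A transposition changes the sign of the alternation, so symmetry gives [alt T I = - alt T I].
    Both the connection terms and the square of [cone_ext] vanish for this reason. *)
Lemma alt_sym k (i j : 'I_k) (T : cotensor R d k) : i != j ->
  (forall I : index k, T [ffun l => I (tperm i j l)] = T I) -> forall I, alt T I = 0.
Proof.
move=> neq_ij symT I; have := alt_perm (tperm i j) T I.
rewrite (eq_alt symT) odd_tperm neq_ij expr1 mulN1r => /eqP.
by rewrite -subr_eq0 opprK -mulr2n mulrn_eq0 => /eqP.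
Qed.

Lemma altD k (T T' : cotensor R d k) I :
  alt (fun J => T J + T' J) I = alt T I + alt T' I.
Proof.
rewrite /alt -mulrDr -big_split /=; congr (_ * _).
by apply: eq_bigr => s _; rewrite mulrDr.
Qed.

Lemma altZ k (c : R) (T : cotensor R d k) I :
  alt (fun J => c * T J) I = c * alt T I.
Proof.
rewrite /alt mulrCA; congr (_ * _); rewrite big_distrr /=.
by apply: eq_bigr => s _; rewrite mulrCA.
Qed.

Lemma alt_sum k (J : finType) (T : J -> cotensor R d k) I :
  alt (fun I => \sum_j T j I) I = \sum_j alt (T j) I.
Proof.
rewrite /alt -big_distrr /= exchange_big /=; congr (_ * _).
by apply: eq_bigr => s _; rewrite big_distrr.
Qed.

Lemma frontE k (V : 'I_d -> cotensor R d k) a J : front V (fcons a J) = V a J.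
Proof. by rewrite /front fcons0; congr V; exact: ftail_fcons. Qed.

Lemma eq_front k (V V' : 'I_d -> cotensor R d k) :
  (forall a, V a =1 V' a) -> front V =1 front V'.
Proof. by move=> e I; exact: e. Qed.

(** The inner alternation runs over the permutations that fix the front slot. Each of them
    reproduces the outer alternation by [alt_perm], and the [k!] equal terms cancel the inner
    normalisation. *)
Lemma alt_front_alt k (V : 'I_d -> cotensor R d k) I :
  alt (front (fun a => alt (V a))) I = alt (front V) I.
Proof.
transitivity (alt (fun I => (k`!%:R)^-1 * \sum_(s : 'S_k) (-1) ^+ s *
    front V [ffun i => I (lift_perm ord0 ord0 s i)]) I).
  apply: eq_alt => J; rewrite /front /alt; congr (_ * _); apply: eq_bigr => s _.
  rewrite ffunE lift_perm_id; congr (_ * V _ _).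
  by apply/ffunP => i; rewrite !ffunE lift_perm_lift.
rewrite altZ alt_sum.
under eq_bigr => s _ do
  rewrite altZ (alt_perm (lift_perm ord0 ord0 s)) odd_lift_perm addbb addFb mulrA
    -expr2 sqrr_sign mul1r.
by rewrite sumr_const card_Sn -[X in _ * X]mulr_natl mulKf // pnatr_eq0 -lt0n fact_gt0.
Qed.

(** A permutation of [k.+1] slots amounts to the image [i] of the front slot together with a
    permutation of [k] slots, and its sign is [(-1) ^+ i] times the sign of the latter. Skewness of
    [V] absorbs the second permutation, which leaves [k!] copies of each term. *)
Lemma alt_front_skew k (V : 'I_d -> cotensor R d k) I :
  (forall a, Defs.skew (V a)) ->
  k.+1%:R * alt (front V) I =
  \sum_(i < k.+1) (-1) ^+ i * V (I i) [ffun j => I (lift i j)].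
Proof.
move=> skV; rewrite /alt.
pose h (p : 'I_k.+1 * 'S_k) := lift_perm ord0 p.1 p.2.
have inj_h : injective h.
  move=> [i s] [j t]; rewrite /h /= => e.
  have eij : i = j by rewrite -(lift_perm_id ord0 i s) e lift_perm_id.
  move: e; rewrite -eij => e; congr (_, _); apply/permP => l.
  by apply: (@lift_inj _ i); rewrite -!(lift_perm_lift ord0) e.
have bij_h : bijective h.
  by apply: inj_card_bij => //; rewrite card_prod !card_Sn card_ord factS.
rewrite (reindex h); last exact: onW_bij.
rewrite -(pair_bigA _ (fun i s => (-1) ^+ h (i, s) *
  front V [ffun l => I (h (i, s) l)])) /= mulrA big_distrr /=.
apply: eq_bigr => i _.
under eq_bigr => s _.
  rewrite /front ffunE /h /= lift_perm_id odd_lift_perm addFb signr_addb.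
  have -> : [ffun l => [ffun l0 => I (lift_perm ord0 i s l0)] (lift ord0 l)] =
            [ffun l => [ffun j => I (lift i j)] (s l)] :> index k.
    by apply/ffunP => l; rewrite !ffunE lift_perm_lift.
  rewrite skV mulrA -(mulrA _ ((-1) ^+ s) ((-1) ^+ s)) -expr2 sqrr_sign mulr1 signr_odd; over.
have k1_neq0 : k.+1%:R != 0 :> R by rewrite pnatr_eq0.
have kfact_neq0 : k`!%:R != 0 :> R by rewrite pnatr_eq0 -lt0n fact_gt0.
rewrite sumr_const card_Sn -[X in _ * X = _]mulr_natl mulrA factS natrM invfM.
by rewrite !mulrA (divff k1_neq0) mul1r (mulVf kfact_neq0) mul1r.
Qed.

End Alternation.

(** * Linear changes of frame and their derivatives *)

Section Pull.
Variables (R : realType) (d : nat).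
Local Notation index k := {ffun 'I_k -> 'I_d}.

Lemma eq_pull k (A : 'M[R]_d) (T T' : cotensor R d k) :
  T =1 T' -> pull A T =1 pull A T'.
Proof. by move=> e I; apply: eq_bigr => K _; rewrite e. Qed.

Lemma pull_mul k (A B : 'M[R]_d) (T : cotensor R d k) I :
  pull A (pull B T) I = pull (B *m A) T I.
Proof.
rewrite /pull; under eq_bigr do rewrite big_distrr /=.
rewrite exchange_big; apply: eq_bigr => K _ /=.
under eq_bigr do rewrite mulrA -big_split /=.
rewrite -big_distrl /=; congr (_ * _).
rewrite -(bigA_distr_bigA (fun i j => A j (I i) * B (K i) j)).
by apply: eq_bigr => i _; rewrite mxE; apply: eq_bigr => j _; rewrite mulrC.
Qed.

Lemma pull1 k (T : cotensor R d k) I : pull 1%:M T I = T I.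
Proof.
rewrite /pull (bigD1 I) //= big1 => [|i _]; last by rewrite mxE eqxx.
rewrite mul1r big1 ?addr0 // => K neqK.
have [i neqi] : exists i, K i != I i.
  by apply/existsP; apply: contraNT neqK => /existsPn e;
     apply/eqP/ffunP => i; apply/eqP; rewrite -[_ == _]negbK e.
by rewrite (bigD1 i) //= mxE (negbTE neqi) !mul0r.
Qed.

Lemma pullZ k (c : R) (A : 'M[R]_d) (T : cotensor R d k) I :
  pull (c *: A) T I = c ^+ k * pull A T I.
Proof.
rewrite /pull big_distrr /=; apply: eq_bigr => K _; rewrite mulrA; congr (_ * _).
under eq_bigr do rewrite mxE.
by rewrite big_split /= prodr_const card_ord.
Qed.

Lemma pullM k (c : R) (A : 'M[R]_d) (T : cotensor R d k) I :
  pull A (fun J => c * T J) I = c * pull A T I.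
Proof. by rewrite /pull big_distrr /=; apply: eq_bigr => K _; rewrite mulrCA. Qed.

Lemma pullD k (A : 'M[R]_d) (T T' : cotensor R d k) I :
  pull A (fun J => T J + T' J) I = pull A T I + pull A T' I.
Proof. by rewrite /pull -big_split /=; apply: eq_bigr => K _; rewrite mulrDr. Qed.

Lemma pull_inj k (A A' : 'M[R]_d) (T T' : cotensor R d k) :
  A *m A' = 1%:M -> pull A T =1 pull A T' -> T =1 T'.
Proof.
move=> AA' e I; rewrite -(pull1 T) -(pull1 T') -AA' -!pull_mul.
exact: eq_pull.
Qed.

Lemma alt_pull k (A : 'M[R]_d) (T : cotensor R d k) I :
  alt (pull A T) I = pull A (alt T) I.
Proof.
rewrite /alt pullM; congr (_ * _); rewrite /pull.
under [RHS]eq_bigr do rewrite big_distrr /=.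
rewrite [RHS]exchange_big; apply: eq_bigr => s _ /=.
rewrite big_distrr /= [RHS](reindex (fun K : index k => [ffun i => K (s^-1%g i)])) /=; last first.
  exists (fun K : index k => [ffun i => K (s i)]) => K _;
    by apply/ffunP => i; rewrite !ffunE ?permK ?permKV.
apply: eq_bigr => K _; rewrite mulrCA; congr (_ * (_ * T _)).
  rewrite [RHS](reindex_inj (@perm_inj _ s)) /=.
  by apply: eq_bigr => i _; rewrite !ffunE permK.
by apply/ffunP => i; rewrite !ffunE permK.
Qed.

Lemma pull_front k (A : 'M[R]_d) (V : 'I_d -> cotensor R d k) I :
  pull A (front V) I = front (fun a J => \sum_e A e a * pull A (V e) J) I.
Proof.
rewrite -[I]fcons_eta frontE /pull big_fcons; apply: eq_bigr => e _ /=.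
rewrite big_distrr /=; apply: eq_bigr => J _; rewrite frontE mulrA; congr (_ * _).
rewrite big_ord_recl !fcons0; congr (_ * _).
by apply: eq_bigr => i _; rewrite !fconsS.
Qed.

(* The derivative of [pull (A + t N)] at [t = 0]. *)
Definition ins k (A N : 'M[R]_d) (T : cotensor R d k) : cotensor R d k := fun I =>
  \sum_(K : index k)
    (\sum_(i < k) \prod_(j < k) (if j == i then N else A) (K j) (I j)) * T K.

Lemma prod_ins k (A N : 'M[R]_d) (K I : index k) i :
  \prod_(j < k) (if j == i then N else A) (K j) (I j) =
  N (K i) (I i) * \prod_(j < k | j != i) A (K j) (I j).
Proof.
rewrite (bigD1 i) //= eqxx; congr (_ * _).
by apply: eq_bigr => j /negbTE ->.
Qed.

Lemma insD k (A N N' : 'M[R]_d) (T : cotensor R d k) I :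
  ins A (N + N') T I = ins A N T I + ins A N' T I.
Proof.
rewrite /ins -big_split /=; apply: eq_bigr => K _; rewrite -mulrDl; congr (_ * _).
rewrite -big_split /=; apply: eq_bigr => i _.
by rewrite !prod_ins mxE mulrDl.
Qed.

Lemma insZ k c (A N : 'M[R]_d) (T : cotensor R d k) I :
  ins A (c *: N) T I = c * ins A N T I.
Proof.
rewrite /ins big_distrr /=; apply: eq_bigr => K _; rewrite mulrA; congr (_ * _).
rewrite big_distrr /=; apply: eq_bigr => i _.
by rewrite !prod_ins mxE -mulrA.
Qed.

Lemma ins0 k (A : 'M[R]_d) (T : cotensor R d k) I : ins A 0 T I = 0.
Proof. by rewrite -(scale0r 0) insZ mul0r. Qed.

Lemma ins_sum (J : finType) k (A : 'M[R]_d) (N : J -> 'M[R]_d) (T : cotensor R d k) I :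
  ins A (\sum_j N j) T I = \sum_j ins A (N j) T I.
Proof.
exact: (big_morph (fun N => ins A N T I) (fun N N' => insD A N N' T I) (ins0 A T I)).
Qed.

(** The inner sum is the action of [G] as a derivation, slot by slot. In the slot concerned the
    pull-back replaces [A] by [G *m A], so connection terms become insertions, to which
    [alt_front_ins] applies. *)
Lemma pull_derivation k (A G : 'M[R]_d) (T : cotensor R d k) I :
  pull A (fun I => \sum_(i < k) \sum_(e < d) G e (I i) * T (subst_index I i e)) I =
  ins A (G *m A) T I.
Proof.
rewrite /pull /ins.
under eq_bigr do rewrite big_distrr /=.
under [RHS]eq_bigr do rewrite big_distrl /=.
rewrite exchange_big [RHS]exchange_big; apply: eq_bigr => i _ /=.
under eq_bigr do rewrite big_distrr /=.
rewrite pair_bigA /=.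
(* Exchanging the value of [K] at slot [i] with the summed index [e] is an involution. After it [T]
   is evaluated at [K], and the sum over [e] is an entry of [G *m A]. *)
pose h (p : index k * 'I_d) := (subst_index p.1 i p.2, p.1 i).
have hK : involutive h.
  move=> [K e]; rewrite /h /=; congr (_, _); last by rewrite ffunE eqxx.
  by apply/ffunP => j; rewrite !ffunE; case: eqP => [->|].
rewrite (reindex_inj (inv_inj hK)) /=.
rewrite -(pair_bigA _ (fun K e => \prod_(j < k) A (subst_index K i e j) (I j) *
  (G (K i) (subst_index K i e i) * T (subst_index (subst_index K i e) i (K i))))) /=.
apply: eq_bigr => K _.
rewrite prod_ins mxE !big_distrl /=.
apply: eq_bigr => e _; rewrite ffunE eqxx.
have -> : subst_index (subst_index K i e) i (K i) = K.
  by apply/ffunP => j; rewrite !ffunE; case: eqP => [->|].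
rewrite mulrCA mulrA -(mulrA _ (A e (I i))); congr (_ * _ * _).
rewrite (bigD1 i) //= ffunE eqxx; congr (_ * _).
by apply: eq_bigr => j /negbTE neq_ji; rewrite ffunE neq_ji.
Qed.

(** The [i]-th term of the insertion couples the derivative index to slot [i] through [N], so the
    symmetry of [N] makes it invariant under the exchange of these two slots. This is the abstract
    form in which the absence of torsion is used. *)
Lemma alt_front_ins k (A : 'M[R]_d) (N : 'I_d -> 'M[R]_d) (T : cotensor R d k) I :
  (forall a b e, N a e b = N b e a) -> alt (front (fun a => ins A (N a) T)) I = 0.
Proof.
move=> symN.
pose V i a : cotensor R d k := fun I => \sum_(K : index k)
  (\prod_(j < k) (if j == i then N a else A) (K j) (I j)) * T K.
transitivity (alt (fun I => \sum_i front (V i) I) I).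
  apply: eq_alt => J; rewrite /front /ins exchange_big /=.
  by apply: eq_bigr => K _; rewrite big_distrl.
rewrite alt_sum big1 // => i _.
apply: (@alt_sym _ _ _ ord0 (lift ord0 i)); first exact: neq_lift.
move=> J; rewrite /front /V; apply: eq_bigr => K _; congr (_ * _).
rewrite !prod_ins !ffunE tpermL tpermR symN; congr (_ * _).
apply: eq_bigr => j neq_ji; rewrite !ffunE tpermD //.
by rewrite (inj_eq (@lift_inj _ _)) eq_sym.
Qed.

End Pull.

(** * Locality of differentiability and symmetry of second derivatives *)

Lemma near_eq_differentiable (R : realType) (V W : normedModType R)
    (f g : V -> W) (x : V) :
  (\near x, f x = g x) -> differentiable f x -> differentiable g x.
Proof.
move=> fg df.
(* [h] vanishes near [x], so the zero map satisfies the estimate that defines its differential; then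
   [g = f + h]. *)
pose h := g - f.
have h0 : h \o shift x = cst (h x) + (\0 : V -> W) +o_ 0 id.
  have hx0 : h x = 0 by rewrite /h !fctE (nbhs_singleton fg) subrr.
  apply/eqaddoP => _/posnumP[e]; near=> y.
  rewrite !fctE /= hx0 !addr0 subr0 /h !fctE.
  have -> : f (y + x) = g (y + x).
    near: y; move: fg; rewrite (near_shift 0 x) /=; apply: filterS => y /=.
    by rewrite subr0.
  by rewrite subrr normr0 mulr_ge0.
have dh0 : 'd h x = \0 :> (V -> W).
  by apply: diff_unique => //; exact: cst_continuous.
have dh : differentiable h x.
  by apply/diff_locallyP; rewrite dh0; split=> //; exact: cst_continuous.
have -> : g = f + h by rewrite /h addrC subrK.
exact: differentiableD.
Unshelve. all: by end_near. Qed.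

Lemma diff_approx (R : realType) (V : normedModType R) (f : V -> R) (x : V) (e : R) :
  differentiable f x -> 0 < e ->
  \forall k \near (0 : V), `|f (k + x) - f x - 'd f x k| <= e * `|k|.
Proof.
move=> df e0; have /diff_locally/eqaddoP/(_ _ e0) := df.
by apply: filterS => k; rewrite !fctE /= opprD addrA.
Qed.

Section Schwarz.
Variables (R : realType) (V : normedModType R).

Lemma is_derive_line (f : V -> R) (u y : V) (t : R) :
  differentiable f (t *: u + y) ->
  is_derive t 1 (fun s => f (s *: u + y)) ('D_u f (t *: u + y)).
Proof.
move=> df.
have dl : is_diff t (fun s : R => s *: u + y) (fun s : R => s *: u).
  rewrite -[X in is_diff _ _ X]addr0.
  exact: is_diffD.
have dfl : differentiable (f \o (fun s : R => s *: u + y)) t.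
  exact: differentiable_comp.
have -> : 'D_u f (t *: u + y) = 'D_1 (f \o (fun s : R => s *: u + y)) t.
  rewrite (deriveE _ dfl) diff_comp //= (deriveE _ df).
  by have -> : 'd (fun s : R => s *: u + y) t 1 = u by rewrite diff_val scale1r.
by apply: derivableP; exact: diff_derivable.
Qed.

(** The mean value theorem along [u] turns the second difference into [h] times a difference of two
    values of ['D_u f]. Expanding both values to first order at [x] leaves
    [h ^+ 2 * 'D_v ('D_u f) x] and an error of order [o(h ^+ 2)]. *)
Lemma second_difference (f : V -> R) (x u v : V) :
  (\forall y \near x, differentiable f y) -> differentiable ('D_u f) x ->
  forall e : R, 0 < e -> \forall h \near 0^'+,
  `|f (h *: u + (h *: v + x)) - f (h *: u + x) - f (h *: v + x) + f x
    - h ^+ 2 * 'D_v ('D_u f) x| <= e * h ^+ 2.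
Proof.
move=> df du e e0.
pose S := `|u| + `|v|.
have S0 : 0 <= S by rewrite addr_ge0.
(* Each of the two expansions has error at most [e / N * (h * S)], so [N >= S + S] is wanted; the
   added [1] keeps [N] positive when [u] and [v] are zero. *)
pose N := S + S + 1.
have N0 : 0 < N by rewrite ltr_wpDl // addr_ge0.
have eN : 0 < e / N by rewrite divr_gt0.
have /nbhs_normP[r /= r0 near_df] := df.
have /nbhs_normP[r' /= r'0 near_du] := diff_approx du eN.
have rN : 0 < Num.min r r' / N by rewrite divr_gt0 // lt_min r0.
near=> h.
have h0 : 0 < h by near: h; exact: nbhs_right_gt.
have hr : h * N < Num.min r r'.
  by rewrite -ltr_pdivlMr //; near: h; exact: nbhs_right_lt.
have norm_lt c k : 0 <= c <= h -> 0 <= k <= h -> `|c *: u + k *: v| <= h * S.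
  move=> /andP[c0 ch] /andP[k0 kh]; apply: le_trans (ler_normD _ _) _.
  by rewrite !normrZ !ger0_norm // mulrDr lerD // ler_wpM2r.
have small c k : 0 <= c <= h -> 0 <= k <= h -> `|c *: u + k *: v| < Num.min r r'.
  move=> c0 k0; apply: le_lt_trans (norm_lt _ _ c0 k0) _; apply: le_lt_trans hr.
  by rewrite ler_pM2l // /N -addrA lerDl addr_ge0.
have hh : 0 <= h <= h by rewrite lexx ltW.
have h00 : 0 <= (0 : R) <= h by rewrite lexx ltW.
have df_at c k : 0 <= c <= h -> 0 <= k <= h -> differentiable f (c *: u + (k *: v + x)).
  move=> c0 k0; apply: near_df; rewrite /= addrA opprD addrCA subrr addr0 normrN.
  by have := small _ _ c0 k0; rewrite lt_min => /andP[].
pose g (t : R) := f (t *: u + (h *: v + x)) - f (t *: u + x).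
pose dg (t : R) := 'D_u f (t *: u + (h *: v + x)) - 'D_u f (t *: u + x).
have g_der t : 0 <= t <= h -> is_derive t 1 g (dg t).
  move=> t0; apply: is_deriveB; apply: is_derive_line; first exact: df_at.
  by have := df_at _ _ t0 h00; rewrite scale0r add0r.
have [||c] := @MVT R g dg 0 h h0.
- by move=> t; rewrite in_itv /= => /andP[/ltW t0 /ltW th]; apply: g_der; rewrite t0.
- apply: derivable_within_continuous => t; rewrite in_itv /= => t0.
  by have [] := g_der _ t0.
rewrite in_itv /= subr0 => /andP[/ltW c0 /ltW ch] gE.
have cc : 0 <= c <= h by rewrite c0.
pose L := 'd ('D_u f) x.
have approx k : 0 <= k <= h ->
    `|'D_u f (c *: u + (k *: v + x)) - 'D_u f x - L (c *: u + k *: v)|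
      <= e / N * (h * S).
  move=> k0; rewrite addrA; apply: le_trans (near_du _ _) _.
    by rewrite /= sub0r normrN; have := small _ _ cc k0; rewrite lt_min => /andP[].
  by rewrite ler_pM2l // norm_lt.
have LD k : L (c *: u + k *: v) = c * L u + k * L v.
  by rewrite [LHS]linearD; congr (_ + _); rewrite [LHS]linearZ.
have := approx h hh; have := approx 0 h00.
rewrite !LD scale0r mul0r add0r addr0 (deriveE _ du) -/L.
set P := 'D_u f (c *: u + x); set Q := 'D_u f (c *: u + _); set D := 'D_u f x => Ple Qle.
have -> : f (h *: u + (h *: v + x)) - f (h *: u + x) - f (h *: v + x) + f x = (Q - P) * h.
  by rewrite -[RHS]gE /g !scale0r !add0r; ring.
have -> : (Q - P) * h - h ^+ 2 * L v =
    h * ((Q - D - (c * L u + h * L v)) - (P - D - c * L u)) by ring.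
rewrite normrM (gtr0_norm h0) expr2 mulrCA ler_pM2l //.
apply: le_trans (ler_normB _ _) _; apply: le_trans (lerD Qle Ple) _.
rewrite -mulrDr -mulrDr mulrCA [leRHS]mulrC ler_pM2l // mulrAC ler_pdivrMr // ler_pM2l //.
by rewrite lerDl.
Unshelve. all: by end_near. Qed.

(** The second difference is symmetric in [u] and [v], and divided by [h ^+ 2] it tends to either
    iterated derivative. This is Young's form of the theorem: it asks for differentiability of the
    first derivatives at [x], which [smooth_on] supplies directly. *)
Lemma schwarz (f : V -> R) (x u v : V) :
  (\forall y \near x, differentiable f y) ->
  differentiable ('D_u f) x -> differentiable ('D_v f) x ->
  'D_v ('D_u f) x = 'D_u ('D_v f) x.
Proof.
move=> df du dv; apply/eqP; rewrite -subr_eq0 -normr_le0.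
apply/ler_addgt0Pr => e e0; rewrite add0r.
have e2 : 0 < e / 2 by rewrite divr_gt0.
have near_u := second_difference v df du e2.
have near_v := second_difference u df dv e2.
have [h [h0 [hu hv]]] := filter_ex (filterI (nbhs_right_gt (0 : R)) (filterI near_u near_v)).
rewrite -(ler_pM2r (exprn_gt0 2 h0)) -[X in _ * X <= _](ger0_norm (exprn_ge0 2 (ltW h0))) -normrM.
rewrite (addrCA (h *: v)) in hv.
have -> : ('D_v ('D_u f) x - 'D_u ('D_v f) x) * h ^+ 2 =
    (f (h *: u + (h *: v + x)) - f (h *: v + x) - f (h *: u + x) + f x
      - h ^+ 2 * 'D_u ('D_v f) x) -
    (f (h *: u + (h *: v + x)) - f (h *: u + x) - f (h *: v + x) + f x
      - h ^+ 2 * 'D_v ('D_u f) x).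
  by move: ('D_v _ _) ('D_u _ _) (f _) (f _) (f _) (f _) => a b c d e' g; ring.
apply: le_trans (ler_normB _ _) _; apply: le_trans (lerD hv hu) _.
by rewrite -mulrDl -splitr.
Qed.

End Schwarz.

(** * Partial derivatives and smooth functions *)

Section PartialDerivatives.
Variables (R : realType) (n : nat).
Implicit Types (f g : 'rV[R]_n -> R) (x : 'rV[R]_n) (O : set 'rV[R]_n).

Lemma near_eq_pd i f g x : (\near x, f x = g x) -> pd i f x = pd i g x.
Proof. exact: near_eq_derive. Qed.

Lemma pd_cst i (a : R) x : pd i (fun=> a) x = 0.
Proof. exact: derive_cst. Qed.

Lemma differentiable_add f g x : differentiable f x -> differentiable g x ->
  differentiable (fun y => f y + g y) x.
Proof. exact: differentiableD. Qed.

Lemma pdD i f g x : differentiable f x -> differentiable g x ->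
  pd i (fun y => f y + g y) x = pd i f x + pd i g x.
Proof. by move=> df dg; apply: deriveD; exact: diff_derivable. Qed.

Lemma differentiable_mul f g x : differentiable f x -> differentiable g x ->
  differentiable (fun y => f y * g y) x.
Proof. exact: differentiableM. Qed.

Lemma pdM i f g x : differentiable f x -> differentiable g x ->
  pd i (fun y => f y * g y) x = pd i f x * g x + f x * pd i g x.
Proof.
move=> df dg; rewrite /pd [LHS]deriveM; [|exact: diff_derivable..].
by rewrite addrC; congr (_ + _); rewrite /GRing.scale /= mulrC.
Qed.

Lemma differentiable_scale (a : R) f x : differentiable f x ->
  differentiable (fun y => a * f y) x.
Proof. by move=> df; apply: differentiable_mul => //; exact: differentiable_cst. Qed.

Lemma pdZ i (a : R) f x : differentiable f x ->
  pd i (fun y => a * f y) x = a * pd i f x.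
Proof.
move=> df; rewrite (@pdM i (fun=> a)) //.
by rewrite pd_cst mul0r add0r.
Qed.

Lemma differentiable_opp f x : differentiable f x ->
  differentiable (fun y => - f y) x.
Proof. exact: differentiableN. Qed.

Lemma pdN i f x : differentiable f x -> pd i (fun y => - f y) x = - pd i f x.
Proof. by move=> df; apply: deriveN; exact: diff_derivable. Qed.

Lemma differentiable_bigsum (J : Type) (r : seq J) (F : J -> 'rV[R]_n -> R) x :
  (forall j, differentiable (F j) x) ->
  differentiable (fun y => \sum_(j <- r) F j y) x.
Proof.
move=> dF; elim: r => [|j r IH].
  by under eq_fun do rewrite big_nil; exact: differentiable_cst.
under eq_fun do rewrite big_cons.
exact: differentiable_add.
Qed.

Lemma pd_sum i (J : Type) (r : seq J) (F : J -> 'rV[R]_n -> R) x :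
  (forall j, differentiable (F j) x) ->
  pd i (fun y => \sum_(j <- r) F j y) x = \sum_(j <- r) pd i (F j) x.
Proof.
move=> dF; elim: r => [|j r IH].
  by under eq_fun do rewrite big_nil; rewrite pd_cst big_nil.
under eq_fun do rewrite big_cons.
by rewrite big_cons pdD ?IH //; exact: differentiable_bigsum.
Qed.

Lemma differentiable_bigprod (J : Type) (r : seq J) (F : J -> 'rV[R]_n -> R) x :
  (forall j, differentiable (F j) x) ->
  differentiable (fun y => \prod_(j <- r) F j y) x.
Proof.
move=> dF; elim: r => [|j r IH].
  by under eq_fun do rewrite big_nil; exact: differentiable_cst.
under eq_fun do rewrite big_cons.
exact: differentiable_mul.
Qed.

(** The differentiated factor is marked by a conditional inside the product, so that the result has
    literally the shape of [ins]. *)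
Lemma pd_prod i k (F : 'I_k -> 'rV[R]_n -> R) x :
  (forall j, differentiable (F j) x) ->
  pd i (fun y => \prod_(j < k) F j y) x =
  \sum_(l < k) \prod_(j < k) (if j == l then pd i (F j) x else F j x).
Proof.
elim: k F => [|k IH] F dF.
  by under eq_fun do rewrite big_ord0; rewrite pd_cst big_ord0.
under eq_fun do rewrite big_ord_recl.
rewrite pdM //; last exact: differentiable_bigprod.
rewrite big_ord_recl big_ord_recl eqxx IH //; congr (_ + _).
rewrite big_distrr /=; apply: eq_bigr => l _.
by rewrite big_ord_recl.
Qed.

Lemma pd_comp1 i (h : R -> R) (dh : R) f x :
  differentiable f x -> is_derive (f x) 1 h dh ->
  differentiable (h \o f) x /\ pd i (h \o f) x = dh * pd i f x.
Proof.
move=> df hh; have dhf : differentiable h (f x).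
  by apply/derivable1_diffP; case: hh.
have dc := differentiable_comp df dhf; split => //.
rewrite /pd (deriveE _ dc) diff_comp //= (deriveE _ df).
have -> : dh = 'd h (f x) 1 by rewrite -deriveE // derive_val.
by rewrite -[X in 'd h _ X]mulr1 [LHS]linearZ /= /GRing.scale /= mulrC.
Qed.

Lemma differentiable_row m (phi : 'rV[R]_n -> 'rV[R]_m) x :
  (forall j, differentiable (fun y => phi y ord0 j) x) -> differentiable phi x.
Proof.
move=> dphi.
have -> : phi = \sum_(j < m) (fun y => phi y ord0 j *: delta_mx ord0 j).
  by apply/funext => y; rewrite fct_sumE {1}[phi y]row_sum_delta.
by apply: differentiable_sum => j; exact: differentiableZl.
Qed.

End PartialDerivatives.

Section SmoothFunctions.
Variables (R : realType) (n : nat).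
Implicit Types (f g : 'rV[R]_n -> R) (x : 'rV[R]_n) (O : set 'rV[R]_n).

Lemma open_near_eq O f g x : open O -> (forall y, O y -> f y = g y) -> O x ->
  \near x, f x = g x.
Proof. by move=> oO fg Ox; apply: filterS fg _; exact: open_nbhs_nbhs. Qed.

Lemma pd_comp m i (phi : 'rV[R]_n -> 'rV[R]_m) (f : 'rV[R]_m -> R) x :
  (forall j, differentiable (fun y => phi y ord0 j) x) -> differentiable f (phi x) ->
  differentiable (fun y => f (phi y)) x /\
  pd i (fun y => f (phi y)) x =
  \sum_(j < m) pd i (fun y => phi y ord0 j) x * pd j f (phi x).
Proof.
move=> /[dup] dphij /differentiable_row dphi df.
have dc := differentiable_comp dphi df; split => //.
rewrite /pd [LHS](deriveE _ dc) diff_comp //= -(deriveE _ dphi).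
rewrite derive_mx; last exact: diff_derivable.
rewrite [X in 'd f _ X]row_sum_delta [LHS]linear_sum; apply: eq_bigr => j _ /=.
by rewrite [LHS]linearZ /= mxE -(deriveE _ df).
Qed.

Lemma iter_pd_rcons s (i : 'I_n) f : iter_pd (rcons s i) f = iter_pd s (pd i f).
Proof. by rewrite /iter_pd foldr_rcons. Qed.

Lemma near_eq_iter_pd O s f g x : open O -> (forall y, O y -> f y = g y) -> O x ->
  iter_pd s f x = iter_pd s g x.
Proof.
move=> oO fg; elim: s x => [|i s IH] x Ox /=; first exact: fg.
by apply: near_eq_pd; exact: open_near_eq oO IH Ox.
Qed.

Lemma smooth_eq O f g : open O -> (forall y, O y -> f y = g y) ->
  smooth_on O f -> smooth_on O g.
Proof.
move=> oO fg sf s x Ox; apply: near_eq_differentiable (sf s x Ox).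
by apply: (open_near_eq oO _ Ox) => y Oy; exact: near_eq_iter_pd oO fg Oy.
Qed.

Lemma smooth_differentiable O f x : smooth_on O f -> O x -> differentiable f x.
Proof. by move=> sf; exact: (sf [::]). Qed.

Lemma smooth_pd O f i : smooth_on O f -> smooth_on O (pd i f).
Proof. by move=> sf s x Ox; rewrite -iter_pd_rcons; exact: sf. Qed.

Lemma smooth_cst O (a : R) : smooth_on O (fun=> a).
Proof.
have H b s : exists c, iter_pd s (fun _ : 'rV[R]_n => b) = (fun=> c).
  elim: s => [|i s [c IH]]; first by exists b.
  by exists 0; rewrite /= IH; apply/funext => y; exact: pd_cst.
by move=> s x _; have [c ->] := H a s; exact: differentiable_cst.
Qed.

Lemma smoothD O f g : open O -> smooth_on O f -> smooth_on O g ->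
  smooth_on O (fun y => f y + g y).
Proof.
move=> oO sf sg s.
have E x : O x -> iter_pd s (fun y => f y + g y) x = iter_pd s f x + iter_pd s g x.
  elim: s x => [//|i s IH] x Ox /=.
  rewrite (near_eq_pd i (open_near_eq oO IH Ox)) pdD //; [exact: sf|exact: sg].
move=> x Ox; apply: (@near_eq_differentiable _ _ _ (fun y => iter_pd s f y + iter_pd s g y)).
  by apply: (open_near_eq oO _ Ox) => y Oy; rewrite E.
by apply: differentiable_add; [exact: sf|exact: sg].
Qed.

(** Induction on the number of derivatives. The product rule for the innermost one leaves two
    products of smooth functions under a shorter list. Their sum is not within reach of [smoothD],
    because these products are so far known to be regular only up to the order of the induction
    hypothesis. *)
Lemma smoothM O f g : open O -> smooth_on O f -> smooth_on O g ->
  smooth_on O (fun y => f y * g y).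
Proof.
move=> oO + + s; have [k] := ubnP (size s); elim: k s f g => // k IH s f g sk sf sg.
case/lastP: s sk => [|s i] sk x Ox.
  by apply: differentiable_mul; [exact: (sf [::])|exact: (sg [::])].
rewrite iter_pd_rcons; rewrite size_rcons ltnS in sk.
have E y : O y -> pd i f y * g y + f y * pd i g y = pd i (fun y => f y * g y) y.
  by move=> Oy; rewrite pdM //; [exact: (sf [::])|exact: (sg [::])].
apply: (@near_eq_differentiable _ _ _ (iter_pd s (fun y => pd i f y * g y + f y * pd i g y))).
  by apply: (open_near_eq oO _ Ox) => y Oy; exact: near_eq_iter_pd oO E Oy.
(* All lists [t] up to the length of [s] are covered, because additivity of [iter_pd s] uses
   differentiability at each intermediate order. *)
have F t : (size t <= size s)%N -> forall y, O y ->
    differentiable (iter_pd t (fun y => pd i f y * g y)) y /\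
    differentiable (iter_pd t (fun y => f y * pd i g y)) y.
  move=> ts y Oy; split; apply: IH => //; try exact: leq_ltn_trans sk; exact: smooth_pd.
have E' t y : (size t <= size s)%N -> O y -> iter_pd t (fun y => pd i f y * g y + f y * pd i g y) y =
    iter_pd t (fun y => pd i f y * g y) y + iter_pd t (fun y => f y * pd i g y) y.
  elim: t y => [//|j t IHt] y ts Oy /=.
  have ts' := ltnW ts; have [d1 d2] := F t ts' y Oy.
  by rewrite -pdD //; apply: near_eq_pd; apply: (open_near_eq oO _ Oy) => z Oz; exact: IHt.
apply: (@near_eq_differentiable _ _ _ (fun y => iter_pd s (fun y => pd i f y * g y) y +
    iter_pd s (fun y => f y * pd i g y) y)).
  by apply: (open_near_eq oO _ Ox) => y Oy; rewrite E'.
by have [d1 d2] := F s (leqnn _) x Ox; exact: differentiable_add.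
Qed.

Lemma smoothN O f : open O -> smooth_on O f -> smooth_on O (fun y => - f y).
Proof.
move=> oO sf; apply: (@smooth_eq _ (fun y => -1 * f y)) => //.
  by move=> y _; rewrite mulN1r.
by apply: smoothM => //; exact: smooth_cst.
Qed.

Lemma smooth_sum O (J : Type) (r : seq J) (F : J -> 'rV[R]_n -> R) : open O ->
  (forall j, smooth_on O (F j)) -> smooth_on O (fun y => \sum_(j <- r) F j y).
Proof.
move=> oO sF; elim: r => [|j r IH].
  by under eq_fun do rewrite big_nil; exact: smooth_cst.
by under eq_fun do rewrite big_cons; exact: smoothD.
Qed.

Lemma pd_pdC O f i j x : open O -> smooth_on O f -> O x ->
  pd i (pd j f) x = pd j (pd i f) x.
Proof.
move=> oO sf Ox; apply: schwarz; [|exact: (sf [:: _])..].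
by apply: filterS (open_nbhs_nbhs (conj oO Ox)) => y; exact: (sf [::]).
Qed.

End SmoothFunctions.

(** * The exterior derivative of homogeneous forms on the cone *)

Section ExteriorDerivative.
Variables (R : realType) (n : nat).
Implicit Types (x : 'rV[R]_n) (m : R).

Definition cone_pd (A : 'I_n.+1) (f : 'rV[R]_n -> R) : 'rV[R]_n -> R := fun x =>
  if unlift ord0 A is Some a then pd a f x else 0.

Lemma sum_tZ (A : 'I_n.+1) (f : 'I_n -> R) :
  \sum_(a < n) tZ R a A * f a = if unlift ord0 A is Some a then f a else 0.
Proof.
rewrite /tZ; case: (unliftP ord0 A) => [b|] ->.
  rewrite (bigD1 b) //= eqxx mul1r big1 ?addr0 // => a neq_ab.
  by rewrite (inj_eq (@lift_inj _ _)) eq_sym (negbTE neq_ab) mul0r.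
by rewrite big1 // => a _; rewrite (negbTE (neq_lift _ _)) mul0r.
Qed.

Lemma tY0 : tY R (ord0 : 'I_n.+1) = 1. Proof. by rewrite /tY eqxx. Qed.

Lemma tYS (a : 'I_n) : tY R (lift ord0 a) = 0.
Proof. by rewrite /tY eq_sym (negbTE (neq_lift _ _)). Qed.

(* On the cone over the chart with coordinates [(s, x)], the coefficients of a
   form of homogeneity degree [m] are [s ^ (m - r) * T x] in the coframe
   [(ds, dx)], where [r] is the number of factors [ds]; the components of its
   derivative along [ds] are [m * T] up to terms killed by alternation. *)
Definition cone_deriv d k m (A : 'I_n.+1) (T : 'rV[R]_n -> cotensor R d k) x :
    cotensor R d k := fun I =>
  m * tY R A * T x I + cone_pd A (fun y => T y I) x.

Lemma cone_deriv0 d k m (T : 'rV[R]_n -> cotensor R d k) :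
  cone_deriv m ord0 T = fun x I => m * T x I.
Proof.
apply/funext => x; apply/funext => I.
by rewrite /cone_deriv /cone_pd unlift_none tY0 mulr1 addr0.
Qed.

Lemma cone_derivS d k m a (T : 'rV[R]_n -> cotensor R d k) :
  cone_deriv m (lift ord0 a) T = fun x I => pd a (fun y => T y I) x.
Proof.
apply/funext => x; apply/funext => I.
by rewrite /cone_deriv /cone_pd liftK tYS mulr0 mul0r add0r.
Qed.

Definition cone_ext k m (T : 'rV[R]_n -> cotensor R n.+1 k) x :
    cotensor R n.+1 k.+1 := fun I =>
  k.+1%:R * alt (front (fun A => cone_deriv m A T x)) I.

Lemma near_eq_cone_ext k m (T T' : 'rV[R]_n -> cotensor R n.+1 k) x I :
  (forall I, \near x, T x I = T' x I) -> cone_ext m T x I = cone_ext m T' x I.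
Proof.
move=> TT'; rewrite /cone_ext; congr (_ * _); apply: eq_alt; apply: eq_front => A J.
rewrite /cone_deriv (nbhs_singleton (TT' J)) /cone_pd; congr (_ + _).
by case: unlift => // a; exact: near_eq_pd.
Qed.

Definition smooth_cotensor d k (O : set 'rV[R]_n) (T : 'rV[R]_n -> cotensor R d k) :=
  forall I, smooth_on O (fun x => T x I).

Lemma smooth_alt d k (O : set 'rV[R]_n) (T : 'rV[R]_n -> cotensor R d k) :
  open O -> smooth_cotensor O T -> smooth_cotensor O (fun x => alt (T x)).
Proof.
move=> oO sT I; rewrite /alt; apply: smoothM => //; first exact: smooth_cst.
apply: smooth_sum => // s; apply: smoothM => //; exact: smooth_cst.
Qed.

Lemma smooth_pull d k (O : set 'rV[R]_n) (B : 'rV[R]_n -> 'M[R]_d)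
    (T : 'rV[R]_n -> cotensor R d k) : open O ->
  (forall i j, smooth_on O (fun x => B x i j)) -> smooth_cotensor O T ->
  smooth_cotensor O (fun x => pull (B x) (T x)).
Proof.
move=> oO sB sT I; rewrite /pull; apply: smooth_sum => // K; apply: smoothM => //.
elim: (index_enum _) => [|i r IH].
  by under eq_fun do rewrite big_nil; exact: smooth_cst.
by under eq_fun do rewrite big_cons; exact: smoothM.
Qed.

Lemma smooth_cone_deriv d k (O : set 'rV[R]_n) m A (T : 'rV[R]_n -> cotensor R d k) :
  open O -> smooth_cotensor O T -> smooth_cotensor O (cone_deriv m A T).
Proof.
move=> oO sT I; apply: smoothD => //; first by apply: smoothM => //; exact: smooth_cst.
by rewrite /cone_pd; case: unlift => [a|]; [exact: smooth_pd|exact: smooth_cst].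
Qed.

Lemma cone_deriv_alt k (O : set 'rV[R]_n) m A (T : 'rV[R]_n -> cotensor R n.+1 k) x I :
  open O -> smooth_cotensor O T -> O x ->
  cone_deriv m A (fun y => alt (T y)) x I = alt (cone_deriv m A T x) I.
Proof.
move=> oO sT Ox; have dT J : differentiable (fun y => T y J) x.
  exact: smooth_differentiable (sT J) Ox.
rewrite /cone_deriv altD altZ; congr (_ + _); rewrite /cone_pd.
case: unlift => [a|]; last by rewrite /alt big1 ?mulr0 // => s _; rewrite mulr0.
rewrite /alt pdZ; last by apply: differentiable_bigsum => s; exact: differentiable_scale.
rewrite pd_sum; last by move=> s; exact: differentiable_scale.
by congr (_ * _); apply: eq_bigr => s _; rewrite pdZ.
Qed.

Lemma cone_derivZ d k m A c (T : 'rV[R]_n -> cotensor R d k) x I :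
  differentiable (fun y => T y I) x ->
  cone_deriv m A (fun y J => c * T y J) x I = c * cone_deriv m A T x I.
Proof.
move=> dT; rewrite /cone_deriv mulrDr mulrCA; congr (_ + _); rewrite /cone_pd.
by case: unlift => [a|]; rewrite ?mulr0 // pdZ.
Qed.

Lemma cone_derivC d k (O : set 'rV[R]_n) m A B (T : 'rV[R]_n -> cotensor R d k) x I :
  open O -> smooth_cotensor O T -> O x ->
  cone_deriv m A (cone_deriv m B T) x I = cone_deriv m B (cone_deriv m A T) x I.
Proof.
move=> oO sT Ox; have dT J : differentiable (fun y => T y J) x.
  exact: smooth_differentiable (sT J) Ox.
have dpT a J : differentiable (pd a (fun y => T y J)) x.
  by apply: smooth_differentiable Ox; exact: smooth_pd.
case: (unliftP ord0 A) => [a|] ->; case: (unliftP ord0 B) => [b|] -> //.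
- by rewrite !cone_derivS; exact: pd_pdC oO (sT I) Ox.
- by rewrite !cone_derivS !cone_deriv0 pdZ.
- by rewrite !cone_derivS !cone_deriv0 pdZ.
Qed.

(** [cone_deriv] commutes with [alt], so the outer alternation absorbs the inner one. The double
    derivative that remains is symmetric in its two indices: partial derivatives commute with each
    other and with multiplication by [m]. *)
Lemma cone_ext_ext k (O : set 'rV[R]_n) m (T : 'rV[R]_n -> cotensor R n.+1 k) x I :
  open O -> smooth_cotensor O T -> O x -> cone_ext m (cone_ext m T) x I = 0.
Proof.
move=> oO sT Ox; rewrite /cone_ext.
have sF : smooth_cotensor O (fun y => front (fun A => cone_deriv m A T y)).
  by move=> J; exact: smooth_cone_deriv.
transitivity (k.+2%:R * (k.+1%:R * alt (front (fun A => front (fun B =>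
    cone_deriv m A (cone_deriv m B T) x))) I)); last first.
  rewrite (@alt_sym _ _ _ ord0 (lift ord0 ord0)); [by rewrite !mulr0|exact: neq_lift|move=> J].
  rewrite /front (cone_derivC _ _ _ _ oO sT Ox) !ffunE tpermL tpermR.
  congr (cone_deriv _ _ _ _ _); apply/ffunP => i; rewrite !ffunE tpermD //.
congr (_ * _); rewrite -[X in _ = _ * X]alt_front_alt -[RHS]altZ.
apply: eq_alt => J; rewrite [LHS]/front [X in _ = _ * X]/front; set A := J ord0.
rewrite cone_derivZ; last exact: smooth_differentiable (smooth_alt oO sF _) Ox.
by congr (_ * _); exact: cone_deriv_alt oO sF Ox.
Qed.

Definition cone_pd_mx d (A : 'I_n.+1) (B : 'rV[R]_n -> 'M[R]_d) x : 'M[R]_d :=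
  \matrix_(i, j) cone_pd A (fun y => B y i j) x.

Lemma cone_deriv_pull d k m A (B : 'rV[R]_n -> 'M[R]_d)
    (T : 'rV[R]_n -> cotensor R d k) x I :
  (forall i j, differentiable (fun y => B y i j) x) ->
  (forall I, differentiable (fun y => T y I) x) ->
  cone_deriv m A (fun y => pull (B y) (T y)) x I =
  pull (B x) (cone_deriv m A T x) I + ins (B x) (cone_pd_mx A B x) (T x) I.
Proof.
move=> dB dT; rewrite /cone_deriv pullD pullM -addrA; congr (_ + _); rewrite /cone_pd.
case: (unliftP ord0 A) => [a|] ->; last first.
  rewrite (_ : cone_pd_mx _ _ _ = 0) ?ins0.
    by rewrite /pull big1 ?addr0 // => K _; rewrite mulr0.
  by apply/matrixP => i j; rewrite !mxE /cone_pd unlift_none.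
have dP (K : {ffun 'I_k -> 'I_d}) : differentiable (fun y => \prod_(i < k) B y (K i) (I i)) x.
  exact: differentiable_bigprod.
rewrite pd_sum; last by move=> K; exact: differentiable_mul.
rewrite /pull /ins -big_split /=; apply: eq_bigr => K _.
rewrite pdM // addrC; congr (_ + _).
rewrite pd_prod //; congr (_ * _); apply: eq_bigr => i _; apply: eq_bigr => j _.
by case: ifP => // _; rewrite mxE /cone_pd liftK.
Qed.

(** The derivative of the frame contributes an insertion of [cone_pd_mx A B]. Its sum with [N A]
    dies under alternation, so it may be traded for minus the insertion of [N A]. The lemma serves
    with [N] the connection terms in a moving frame, and with [N = 0] for a Jacobian, whose
    derivative is symmetric by itself. *)
Lemma cone_ext_pull k m (B : 'rV[R]_n -> 'M[R]_n.+1) (N : 'I_n.+1 -> 'M[R]_n.+1)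
    (T : 'rV[R]_n -> cotensor R n.+1 k) x I :
  (forall i j, differentiable (fun y => B y i j) x) ->
  (forall I, differentiable (fun y => T y I) x) ->
  (forall A E C, (cone_pd_mx A B x + N A) E C = (cone_pd_mx C B x + N C) E A) ->
  cone_ext m (fun y => pull (B y) (T y)) x I =
  k.+1%:R * alt (front (fun A J =>
    pull (B x) (cone_deriv m A T x) J - ins (B x) (N A) (T x) J)) I.
Proof.
move=> dB dT symN; rewrite /cone_ext; congr (_ * _).
have := @alt_front_ins _ _ _ (B x) (fun A => cone_pd_mx A B x + N A) (T x) I (fun A C E => symN A E C).
move=> alt0; rewrite -[RHS]addr0 -alt0 -altD.
apply: eq_alt; rewrite /front => J; rewrite cone_deriv_pull // insD.
by rewrite [X in _ = _ + X]addrC addrA subrK.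
Qed.

End ExteriorDerivative.

(** * Block matrices and changes of splitting *)

Section BlockEntries.
Variables (R : Type) (n : nat).
Variables (A : 'M[R]_1) (B : 'rV[R]_n) (C : 'cV[R]_n) (D : 'M[R]_n).

Lemma block_mx00 : block_mx A B C D ord0 ord0 = A ord0 ord0.
Proof. by rewrite -(block_mxEul A B C D); congr (fun_of_matrix _ _ _); exact: val_inj. Qed.

Lemma block_mx0S b : block_mx A B C D ord0 (lift ord0 b) = B ord0 b.
Proof. by rewrite -(block_mxEur A B C D); congr (fun_of_matrix _ _ _); exact: val_inj. Qed.

Lemma block_mxS0 a : block_mx A B C D (lift ord0 a) ord0 = C a ord0.
Proof. by rewrite -(block_mxEdl A B C D); congr (fun_of_matrix _ _ _); exact: val_inj. Qed.

Lemma block_mxSS a b : block_mx A B C D (lift ord0 a) (lift ord0 b) = D a b.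
Proof. by rewrite -(block_mxEdr A B C D); congr (fun_of_matrix _ _ _); exact: val_inj. Qed.

End BlockEntries.

Definition block_mxE := (block_mx00, block_mx0S, block_mxS0, block_mxSS).

Lemma ord0_or_lift n (P : 'I_n.+1 -> Prop) :
  P ord0 -> (forall a, P (lift ord0 a)) -> forall A, P A.
Proof. by move=> P0 PS A; case: (unliftP ord0 A) => [a|] ->. Qed.

Section SplittingChange.
Variables (R : realType) (n : nat).
Implicit Types v : 'I_n -> R.

Lemma splitting_changeE v :
  (splitting_change v ord0 ord0 = 1) *
  (forall b, splitting_change v ord0 (lift ord0 b) = - v b) *
  (forall a, splitting_change v (lift ord0 a) ord0 = 0) *
  (forall a b, splitting_change v (lift ord0 a) (lift ord0 b) = (a == b)%:R).
Proof. by rewrite /splitting_change; do !split => *; rewrite block_mxE !mxE. Qed.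

Lemma splitting_changeM v v' :
  splitting_change v *m splitting_change v' = splitting_change (fun b => v b + v' b).
Proof.
apply: etrans (@mulmx_block R 1 n 1 n 1 n _ _ _ _ _ _ _ _) _.
rewrite !(mul1mx, mulmx1, mul0mx, mulmx0, addr0, add0r).
by congr block_mx; apply/rowP => b; rewrite !mxE opprD addrC.
Qed.

Lemma splitting_change0 v : v =1 (fun=> 0) -> splitting_change v = 1%:M.
Proof.
move=> v0; apply/matrixP => A B; rewrite [RHS]mxE.
elim/ord0_or_lift: A => [|a]; elim/ord0_or_lift: B => [|b]; rewrite splitting_changeE //.
by rewrite v0 oppr0 (negbTE (neq_lift _ _)).
Qed.

Lemma splitting_changeVr v :
  splitting_change v *m splitting_change (fun b => - v b) = 1%:M.
Proof. by rewrite splitting_changeM splitting_change0 // => b; rewrite subrr. Qed.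

End SplittingChange.

(** * Curvature, Ricci and Schouten tensors in a chart *)

Section SmoothConnection.
Variables (R : realType) (n : nat) (M : smooth_manifold R n).
Variables (nab : connection M) (c : atlas M).
Let O := chart_image c.

Lemma chart_image_open : open O.
Proof. exact: coord_open. Qed.

Let oO := chart_image_open.

Lemma smooth_vcov xi b e : (forall e, smooth_on O (fun x => xi x e)) ->
  smooth_on O (vcov (nab c) xi b e).
Proof.
move=> sxi; apply: smoothD => //; first exact: smooth_pd.
apply: smooth_sum => // d; apply: smoothM => //; exact: christoffel_smooth.
Qed.

Lemma smooth_vcov2 xi a b e : (forall e, smooth_on O (fun x => xi x e)) ->
  smooth_on O (vcov2 (nab c) xi a b e).
Proof.
move=> sxi; apply: smoothD => //; last first.
  by apply: smooth_sum => // d; apply: smoothM => //; [exact: christoffel_smooth|exact: smooth_vcov].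
apply: smoothD => //; first by apply: smooth_pd; exact: smooth_vcov.
apply: smoothN => //; apply: smooth_sum => // d; apply: smoothM => //.
  exact: christoffel_smooth.
exact: smooth_vcov.
Qed.

Lemma smooth_ricci a b : smooth_on O (ricci (nab c) a b).
Proof.
apply: smooth_sum => // e; apply: smoothD => //.
  by apply: smooth_vcov2 => d; exact: smooth_cst.
by apply: smoothN => //; apply: smooth_vcov2 => d; exact: smooth_cst.
Qed.

Lemma smooth_schouten a b : smooth_on O (schouten (nab c) a b).
Proof.
apply: smoothM => //; last exact: smooth_cst.
apply: smoothD => //; first exact: smooth_ricci.
apply: smoothM => //; first exact: smooth_cst.
apply: smoothM => //; last exact: smooth_cst.
by apply: smoothD => //; [|apply: smoothN => //]; exact: smooth_ricci.
Qed.

Lemma smooth_weight_form a : smooth_on O (weight_form (nab c) a).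
Proof.
apply: smoothM => //; last exact: smooth_cst.
by apply: smooth_sum => // i; exact: christoffel_smooth.
Qed.

Lemma smooth_tractor_conn_matrix a A B :
  smooth_on O (fun x => tractor_conn_matrix (nab c) a x A B).
Proof.
rewrite /tractor_conn_matrix.
elim/ord0_or_lift: A => [|e]; elim/ord0_or_lift: B => [|d].
- apply: (@smooth_eq _ _ _ (fun x => - weight_form (nab c) a x)) => //.
    by move=> x _; rewrite block_mxE mxE eqxx.
  by apply: smoothN => //; exact: smooth_weight_form.
- apply: (@smooth_eq _ _ _ (fun x => - schouten (nab c) a d x)) => //.
    by move=> x _; rewrite block_mxE mxE.
  by apply: smoothN => //; exact: smooth_schouten.
- apply: (@smooth_eq _ _ _ (fun x => (e == a)%:R)) => //; last exact: smooth_cst.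
  by move=> x _; rewrite block_mxE mxE.
- apply: (@smooth_eq _ _ _ (fun x => nab c a x e d + - (weight_form (nab c) a x * (e == d)%:R))) => //.
    by move=> x _; rewrite block_mxE !mxE mulr_natr.
  apply: smoothD => //; first exact: christoffel_smooth.
  apply: smoothN => //; apply: smoothM => //; last exact: smooth_cst.
  exact: smooth_weight_form.
Qed.

Lemma smooth_cov d k (A : 'I_n -> 'rV[R]_n -> 'M[R]_d) th w (T : 'rV[R]_n -> cotensor R d k) a :
  (forall a e l, smooth_on O (fun x => A a x e l)) ->
  (forall a, smooth_on O (th a)) -> smooth_cotensor O T ->
  smooth_cotensor O (cov A th w T a).
Proof.
move=> sA sth sT I; apply: smoothD => //; last first.
  apply: smoothN => //; apply: smooth_sum => // i; apply: smooth_sum => // e.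
  exact: smoothM.
apply: smoothD => //; first exact: smooth_pd.
by apply: smoothM => //; apply: smoothM => //; exact: smooth_cst.
Qed.

Lemma smooth_thomas k w (F : tractor_field M k) :
  smooth_cotensor O (F nab c) -> smooth_cotensor O (thomas w F nab c).
Proof.
move=> sF I; apply: smoothD => //.
  by apply: smoothM => //; exact: smooth_cst.
apply: smooth_sum => // a; apply: smoothM => //; first exact: smooth_cst.
apply: smooth_cov => //; first exact: smooth_tractor_conn_matrix.
exact: smooth_weight_form.
Qed.

Lemma smooth_scrD k w (F : tractor_field M k) :
  smooth_cotensor O (F nab c) -> smooth_cotensor O (scrD w F nab c).
Proof.
move=> sF I; apply: smoothM => //; first exact: smooth_cst.
by apply: smooth_alt => //; exact: smooth_thomas.
Qed.

Lemma curvatureE a b e d x : O x ->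
  curvature (nab c) a b e d x =
  pd a (fun y => nab c b y e d) x - pd b (fun y => nab c a y e d) x
  + \sum_(l < n) (nab c a x e l * nab c b x l d - nab c b x e l * nab c a x l d).
Proof.
move=> Ox; rewrite /curvature /vcov2.
have vE b' e' : vcov (nab c) (fun (_ : 'rV_n) (l : 'I_n) => (l == d)%:R) b' e' =
    (fun y => nab c b' y e' d).
  apply/funext => y; rewrite /vcov pd_cst add0r (bigD1 d) //= eqxx mulr1.
  by rewrite big1 ?addr0 // => l /negbTE ->; rewrite mulr0.
rewrite !vE; under eq_bigr do rewrite vE; under [X in _ + X - _]eq_bigr do rewrite vE.
under [X in _ - (_ - X + _)]eq_bigr do rewrite vE.
under [X in _ - (_ + X)]eq_bigr do rewrite vE.
rewrite sumrB.
(* The connection terms acting on the derivative index agree because the torsion vanishes; they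
   cancel in the antisymmetrisation. *)
have -> : \sum_(l < n) nab c a x l b * nab c l x e d = \sum_(l < n) nab c b x l a * nab c l x e d.
  by apply: eq_bigr => l _; rewrite (torsion_free nab Ox).
set s1 := \sum_(l < n) nab c b x l a * _.
by move: (pd _ _ _) (pd _ _ _) (\sum_(l < n) _) (\sum_(l < n) _) s1 => *; ring.
Qed.

(** The traced first Bianchi identity. In the coordinate expression of the Ricci tensor, vanishing
    torsion makes every term symmetric except the derivative of the trace of the Christoffel
    symbols; [n.+1] undoes the normalisation of [weight_form]. *)
Lemma ricci_antisym a b x : O x ->
  ricci (nab c) a b x - ricci (nab c) b a x =
  - (n.+1%:R * (pd a (weight_form (nab c) b) x - pd b (weight_form (nab c) a) x)).
Proof.
move=> Ox.
have dG a' e' d' : differentiable (fun y => nab c a' y e' d') x.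
  exact: smooth_differentiable (christoffel_smooth nab a' e' d') Ox.
have tf i j l e : pd i (fun y => nab c j y l e) x = pd i (fun y => nab c e y l j) x.
  by apply: near_eq_pd; apply: (open_near_eq oO _ Ox) => y Oy; rewrite (torsion_free nab Oy).
have pd_tr i j : \sum_(l < n) pd i (fun y => nab c l y l j) x =
    n.+1%:R * pd i (weight_form (nab c) j) x.
  rewrite /weight_form.
  have -> : (fun y => \tr (nab c j y) / n.+1%:R) =
            (fun y => n.+1%:R^-1 * \sum_(l < n) nab c j y l l).
    by apply/funext => y; rewrite mulrC.
  rewrite pdZ; last exact: differentiable_bigsum.
  rewrite mulrA divff ?pnatr_eq0 // mul1r pd_sum //.
  by apply: eq_bigr => l _.
have ricciE i j : ricci (nab c) i j x =
    \sum_(l < n) pd l (fun y => nab c i y l j) x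
    - n.+1%:R * pd i (weight_form (nab c) j) x
    + \sum_(l < n) \sum_(e < n) nab c l x l e * nab c i x e j
    - \sum_(l < n) \sum_(e < n) nab c i x l e * nab c l x e j.
  rewrite -pd_tr -sumrB -big_split -sumrB; apply: eq_bigr => l _ /=.
  by rewrite curvatureE // sumrB addrA.
rewrite !ricciE.
have -> : \sum_(l < n) pd l (fun y => nab c b y l a) x =
          \sum_(l < n) pd l (fun y => nab c a y l b) x.
  by apply: eq_bigr => l _; rewrite tf.
have -> : \sum_(l < n) \sum_(e < n) nab c l x l e * nab c b x e a =
          \sum_(l < n) \sum_(e < n) nab c l x l e * nab c a x e b.
  by apply: eq_bigr => l _; apply: eq_bigr => e _; rewrite (torsion_free nab Ox b).
have -> : \sum_(l < n) \sum_(e < n) nab c b x l e * nab c l x e a =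
          \sum_(l < n) \sum_(e < n) nab c a x l e * nab c l x e b.
  rewrite exchange_big; apply: eq_bigr => l _; apply: eq_bigr => e _.
  by rewrite (torsion_free nab Ox e l a) (torsion_free nab Ox l e b) mulrC.
move: (\sum_(l < n) _) (\sum_(l < n) _) (\sum_(l < n) _) (pd a _ _) (pd b _ _) n.+1%:R.
by move=> *; ring.
Qed.

(** Adding [beta] multiplies the antisymmetric part of the Ricci tensor by
    [1 - 2 / (n + 1) = (n - 1) / (n + 1)]. Division by [n - 1], nonzero as [n >= 2], leaves
    [1 / (n + 1)], which cancels the factor in [ricci_antisym]. *)
Lemma schouten_antisym a b x : (2 <= n)%N -> O x ->
  schouten (nab c) a b x - schouten (nab c) b a x =
  - (pd a (weight_form (nab c) b) x - pd b (weight_form (nab c) a) x).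
Proof.
move=> n_ge2 Ox; rewrite /schouten /beta.
have -> : ricci (nab c) b a x = ricci (nab c) a b x +
    n.+1%:R * (pd a (weight_form (nab c) b) x - pd b (weight_form (nab c) a) x).
  by rewrite -[X in _ + X]opprK -(ricci_antisym a b Ox) opprB addrC subrK.
have n1_neq0 : n.-1%:R != 0 :> R by rewrite pnatr_eq0 -lt0n -ltnS prednK // ltnW.
have n1E : n.+1%:R = n.-1%:R + 2 :> R by rewrite -natrD addn2 prednK // ltnW.
have : n.+1%:R != 0 :> R by rewrite pnatr_eq0.
rewrite n1E; move: n.-1%:R n1_neq0 (ricci _ _ _ _) (pd a _ _) (pd b _ _) => N N0 r u v N2.
by field; rewrite N0 N2.
Qed.


End SmoothConnection.

(** * The Thomas operator in the volume frame *)

Lemma sum_splitting_change (R : realType) n (v : 'I_n -> R) (X : 'I_n.+1 -> R) A :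
  \sum_E splitting_change v E A * X E =
  if unlift ord0 A is Some a then X (lift ord0 a) - v a * X ord0 else X ord0.
Proof.
rewrite big_ord_recl; case: (unliftP ord0 A) => [a|] ->; rewrite splitting_changeE.
  rewrite (bigD1 a) //= splitting_changeE eqxx mul1r big1 => [|b /negbTE neq_ba].
    by rewrite addr0 mulNr addrC.
  by rewrite splitting_changeE neq_ba mul0r.
by rewrite mul1r big1 ?addr0 // => b _; rewrite splitting_changeE mul0r.
Qed.

(** This is how weight moves between the slots and the density part: a scalar in the connection
    matrix counts once per slot, which turns [w] into [w + k]. *)
Lemma sum_subst_scalar (R : realType) d k (c : R) (T : cotensor R d k)
    (I : {ffun 'I_k -> 'I_d}) :
  \sum_(i < k) \sum_(e < d) c%:M e (I i) * T (subst_index I i e) =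
  k%:R * c * T I.
Proof.
transitivity (\sum_(i < k) c * T I); last by rewrite sumr_const card_ord -mulrA mulr_natl.
apply: eq_bigr => i _; rewrite (bigD1 (I i)) //= mxE eqxx mulr1n big1 ?addr0 => [|e neq_e].
  by congr (_ * T _); apply/ffunP => j; rewrite ffunE; case: eqP => [->|].
by rewrite mxE (negbTE neq_e) mulr0n mul0r.
Qed.

Section ScrDConeExt.
Variables (R : realType) (n : nat) (M : smooth_manifold R n).
Variables (nab : connection M) (c : atlas M).
Local Notation O := (chart_image c).
Local Notation th a x := (weight_form (nab c) a x).

(* The splitting of the representative of the projective class that preserves
   the coordinate volume, i.e. for which [weight_form] vanishes. *)
Definition volume_frame (x : 'rV[R]_n) : 'M[R]_n.+1 :=
  splitting_change (fun a => weight_form (nab c) a x).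

(* The connection matrices of the Thomas operator on tractors of weight [w] and
   rank [k], once [w + k] is assigned to the density part. *)
Definition thomas_matrix (A : 'I_n.+1) (x : 'rV[R]_n) : 'M[R]_n.+1 :=
  if unlift ord0 A is Some a
  then tractor_conn_matrix (nab c) a x + (th a x)%:M else 1%:M.

Lemma thomas_matrix0 x : thomas_matrix ord0 x = 1%:M.
Proof. by rewrite /thomas_matrix unlift_none. Qed.

Lemma thomas_matrixE a x :
  (thomas_matrix (lift ord0 a) x ord0 ord0 = 0) *
  (forall d, thomas_matrix (lift ord0 a) x ord0 (lift ord0 d) = - schouten (nab c) a d x) *
  (forall e, thomas_matrix (lift ord0 a) x (lift ord0 e) ord0 = (e == a)%:R) *
  (forall e d, thomas_matrix (lift ord0 a) x (lift ord0 e) (lift ord0 d) = nab c a x e d).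
Proof.
rewrite /thomas_matrix liftK /tractor_conn_matrix; do !split => *; rewrite [LHS]mxE block_mxE !mxE //.
- exact: addNr.
- exact: addr0.
- exact: addr0.
- exact: subrK.
Qed.

(** Directions [ord0] and [lift ord0 a] receive one common shape, derivative minus connection. In
    direction [ord0] the identity matrix removes [k] from [w + k]; in the others the added [th a] in
    every slot is balanced by the larger weight. *)
Lemma thomasE k w (F : tractor_field M k) x I :
  thomas w F nab c x I =
  front (fun A J => cone_deriv (w + k%:R) A (F nab c) x J
    + (if unlift ord0 A is Some a then (w + k%:R) * th a x else 0) * F nab c x J
    - \sum_(i < k) \sum_(e < n.+1) thomas_matrix A x e (J i) * F nab c x (subst_index J i e)) I.
Proof.
rewrite /thomas; apply: eq_front => A J; rewrite sum_tZ.
case: (unliftP ord0 A) => [a|] ->.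
  rewrite tYS mulr0 mul0r add0r cone_derivS /tractor_cov /cov /thomas_matrix liftK.
  under [X in _ = _ - X]eq_bigr => i _.
    under eq_bigr do rewrite mxE mulrDl.
    rewrite big_split /=; over.
  rewrite big_split /= (sum_subst_scalar (th a x) (F nab c x) J).
  by move: (pd _ _ _) (\sum_(i < k) _) (F nab c x J) => p s f; ring.
rewrite tY0 mulr1 cone_deriv0 mul0r !addr0 thomas_matrix0.
by rewrite (sum_subst_scalar 1 (F nab c x) J); ring.
Qed.

(** [N] is the connection on the cone in the moving frame, namely the derivative of the frame plus
    the transformed [thomas_matrix], and its symmetry is absence of torsion. If [A] or [C] is
    [ord0], both sides are an entry of [volume_frame]. Otherwise the row [E = ord0] is
    [schouten_antisym], and the remaining rows are [torsion_free]. *)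
Lemma thomas_torsion_free A E C x : (2 <= n)%N -> O x ->
  let N A := cone_pd_mx A volume_frame x +
    \sum_D volume_frame x D A *: (thomas_matrix D x *m volume_frame x) in
  N A E C = N C E A.
Proof.
move=> n_ge2 Ox N.
have NE A' E' C' : N A' E' C' = cone_pd A' (fun y => volume_frame y E' C') x +
    \sum_D volume_frame x D A' * \sum_L thomas_matrix D x E' L * volume_frame x L C'.
  rewrite !mxE summxE; congr (_ + _); apply: eq_bigr => D _.
  by rewrite !mxE.
have NE0 E' C' : N ord0 E' C' = volume_frame x E' C'.
  rewrite NE sum_splitting_change unlift_none thomas_matrix0 /cone_pd unlift_none add0r.
  rewrite (bigD1 E') //= mxE eqxx mul1r big1 ?addr0 // => L neq_L.
  by rewrite mxE eq_sym (negbTE neq_L) mul0r.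
have NES a E' C' : N (lift ord0 a) E' C' = pd a (fun y => volume_frame y E' C') x +
    \sum_L thomas_matrix (lift ord0 a) x E' L * volume_frame x L C'
    - th a x * volume_frame x E' C'.
  rewrite -[X in _ = _ - _ * X]NE0 !NE !sum_splitting_change liftK unlift_none.
  by rewrite /cone_pd liftK unlift_none add0r addrA.
have pd_frame a b : pd a (fun y => volume_frame y ord0 (lift ord0 b)) x =
    - pd a (weight_form (nab c) b) x.
  rewrite -pdN; last exact: smooth_differentiable (smooth_weight_form nab b) Ox.
  by congr (pd _ _ _); apply/funext => y; rewrite splitting_changeE.
have pd_frameS a b C' : pd a (fun y => volume_frame y (lift ord0 b) C') x = 0.
  have -> : (fun y => volume_frame y (lift ord0 b) C') = (fun=> (C' == lift ord0 b)%:R).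
    apply/funext => y; elim/ord0_or_lift: C' => [|d]; rewrite splitting_changeE.
      by rewrite (negbTE (neq_lift _ _)).
    by rewrite (inj_eq (@lift_inj _ _)) eq_sym.
  exact: pd_cst.
have pd_frame0 a : pd a (fun y => volume_frame y ord0 ord0) x = 0.
  rewrite (_ : (fun y => _) = fun=> 1); first exact: pd_cst.
  by apply/funext => y; rewrite splitting_changeE.
have sumE a E' : \sum_L thomas_matrix (lift ord0 a) x E' L * volume_frame x L ord0 =
    thomas_matrix (lift ord0 a) x E' ord0.
  rewrite big_ord_recl splitting_changeE mulr1 big1 ?addr0 // => L _.
  by rewrite splitting_changeE mulr0.
have sumES a E' d : \sum_L thomas_matrix (lift ord0 a) x E' L * volume_frame x L (lift ord0 d) =
    thomas_matrix (lift ord0 a) x E' (lift ord0 d) - thomas_matrix (lift ord0 a) x E' ord0 * th d x.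
  rewrite big_ord_recl splitting_changeE mulrN (bigD1 d) //= splitting_changeE eqxx mulr1.
  rewrite big1 ?addr0; first by rewrite addrC.
  by move=> L /negbTE neq_L; rewrite splitting_changeE neq_L mulr0.
have N0S a E' : N (lift ord0 a) E' ord0 = volume_frame x E' (lift ord0 a).
  rewrite NES sumE; elim/ord0_or_lift: E' => [|e].
    by rewrite pd_frame0 !thomas_matrixE !splitting_changeE mulr1 !add0r.
  by rewrite pd_frameS !thomas_matrixE !splitting_changeE mulr0 subr0 add0r.
elim/ord0_or_lift: A => [|a]; elim/ord0_or_lift: C => [|d].
- by [].
- by rewrite NE0 N0S.
- by rewrite NE0 N0S.
rewrite !NES !sumES; elim/ord0_or_lift: E => [|e].
  rewrite !pd_frame !thomas_matrixE !splitting_changeE !mul0r !subr0.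
  have := schouten_antisym nab a d n_ge2 Ox.
  move: (pd _ _ _) (pd _ _ _) (schouten _ _ _ _) (schouten _ _ _ _) => p q s t /eqP.
  by rewrite subr_eq => /eqP ->; ring.
rewrite !pd_frameS !thomas_matrixE !splitting_changeE (torsion_free nab Ox a e d).
by ring.
Qed.

(** Pulled back to the volume frame, the connection terms of [thomasE] become insertions of
    [thomas_matrix E x *m volume_frame x]; [cone_ext_pull] exchanges them for the derivative of the
    frame. *)
Lemma scrD_cone_ext k w (F : tractor_field M k) x I : (2 <= n)%N ->
  smooth_cotensor O (F nab c) -> O x ->
  pull (volume_frame x) (scrD w F nab c x) I =
  cone_ext (w + k%:R) (fun y => pull (volume_frame y) (F nab c y)) x I.
Proof.
move=> n_ge2 sF Ox.
have dF J : differentiable (fun y => F nab c y J) x.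
  exact: smooth_differentiable (sF J) Ox.
have dB i j : differentiable (fun y => volume_frame y i j) x.
  rewrite /volume_frame.
  elim/ord0_or_lift: i => [|a]; elim/ord0_or_lift: j => [|b];
    (under eq_fun do rewrite splitting_changeE); try exact: differentiable_cst.
  by apply: differentiable_opp; apply: smooth_differentiable Ox; exact: smooth_weight_form.
rewrite (cone_ext_pull _ _ dB dF (fun A E C => thomas_torsion_free A E C n_ge2 Ox)).
rewrite /scrD pullM; congr (_ * _); rewrite -alt_pull; apply: eq_alt => J.
rewrite (eq_pull _ (thomasE w F x)) pull_front; apply: eq_front => A K.
set B := volume_frame x; set m := w + k%:R.
pose V E K := cone_deriv m E (F nab c) x K
    + (if unlift ord0 E is Some a then m * th a x else 0) * F nab c x K.
transitivity (\sum_E B E A * (pull B (V E) K - ins B (thomas_matrix E x *m B) (F nab c x) K)).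
  apply: eq_bigr => E _; congr (_ * _).
  rewrite -(pull_derivation B) -mulN1r -pullM -pullD.
  by apply: eq_pull => L; rewrite mulN1r.
under eq_bigr do rewrite mulrBr.
rewrite sumrB ins_sum; congr (_ - _); last by apply: eq_bigr => E _; rewrite insZ.
transitivity (pull B (fun K => \sum_E B E A * V E K) K).
  rewrite /pull; under eq_bigr do rewrite big_distrr /=.
  rewrite exchange_big; apply: eq_bigr => L _; rewrite big_distrr /=.
  by apply: eq_bigr => E _; rewrite mulrCA.
(* Column [lift ord0 a] of the frame subtracts [th a] times the derivative in direction [ord0],
   which is multiplication by [m]; this cancels the density term [m * th a]. *)
apply: eq_pull => L; rewrite sum_splitting_change /V unlift_none mul0r addr0 cone_deriv0.
case: (unliftP ord0 A) => [a|] ->; last by rewrite cone_deriv0.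
rewrite liftK; move: (weight_form _ _ _) (cone_deriv _ _ _ _ _) (F _ _ _ _) => t D f.
by ring.
Qed.

End ScrDConeExt.

(** * Densities and connection forms under changes of charts *)

Lemma pd_det (R : realType) n d (i : 'I_n) (A : 'rV[R]_n -> 'M[R]_d) x :
  (forall j l, differentiable (fun y => A y j l) x) ->
  pd i (fun y => \det (A y)) x =
  \tr ((\matrix_(j, l) pd i (fun y => A y j l) x) *m \adj (A x)).
Proof.
move=> dA; rewrite /determinant pd_sum; last first.
  move=> s; apply: differentiable_mul; first exact: differentiable_cst.
  exact: differentiable_bigprod.
under eq_bigr => s _.
  rewrite pdZ; last exact: differentiable_bigprod.
  rewrite pd_prod // big_distrr /=; over.
rewrite exchange_big /mxtrace; apply: eq_bigr => j _ /=.
(* Jacobi's formula: [A'] is [A x] with row [j] differentiated. Expansion along that row involves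
   only minors of [A x], that is, entries of the adjugate. *)
pose A' : 'M[R]_d := \matrix_(l, e) if l == j then pd i (fun y => A y l e) x else A x l e.
transitivity (\det A').
  by apply: eq_bigr => s _; congr (_ * _); apply: eq_bigr => l _; rewrite mxE.
rewrite (expand_det_row _ j) mxE; apply: eq_bigr => l _.
rewrite !mxE eqxx; congr (_ * _); rewrite /cofactor; congr (_ * \det _).
by apply/matrixP => e f; rewrite !mxE eq_sym (negbTE (neq_lift _ _)).
Qed.

(** Both signs of [z] occur, since a change of charts may reverse orientation. *)
Lemma is_derive_ln_norm (R : realType) (z : R) : z != 0 ->
  is_derive z 1 (fun t => ln `|t|) z^-1.
Proof.
rewrite neq_lt => /orP[z_lt0|z_gt0].
  have dlnN : is_derive z 1 ((@ln R) \o -%R) z^-1.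
    rewrite -[z^-1]opprK -invrN -[- _^-1]mulrN1; apply: is_derive1_comp.
    by apply: is_derive1_ln; rewrite oppr_gt0.
  apply: near_eq_is_derive dlnN.
  by apply: filterS (lt_nbhsl z_lt0) => t t_lt0; rewrite /= ltr0_norm.
apply: near_eq_is_derive (is_derive1_ln z_gt0).
by apply: filterS (lt_nbhsr z_gt0) => t t_gt0; rewrite gtr0_norm.
Qed.

Section ChartChange.
Variables (R : realType) (n : nat) (M : smooth_manifold R n) (c c' : atlas M).
Local Notation O := (overlap c c').
Local Notation phi := (transition c c').
Local Notation J := (jac c c').

Lemma overlapP x : O x <-> chart_image c x /\ Defs.dom c' (param c x).
Proof.
split=> [[p [cp c'p] <-]|[[p cp <-]]].
  by split; [exists p|rewrite coordK].
by rewrite coordK // => c'p; exists p.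
Qed.

Lemma overlap_sub x : O x -> chart_image c x.
Proof. by case/overlapP. Qed.

Lemma open_overlap : open O.
Proof.
rewrite openE => x /overlapP[cx c'x].
have := @param_continuous _ _ M c.
have oc : open (Defs.coord c @` Defs.dom c) by exact: coord_open.
rewrite (continuous_open_subspace _ oc) => /(_ x (mem_set cx)) cont.
have nbhs_dom : nbhs x (param c @^-1` Defs.dom c').
  by apply: cont; exact: open_nbhs_nbhs (conj (dom_open c') c'x).
have nbhs_chart : nbhs x (chart_image c) by exact: open_nbhs_nbhs (conj oc cx).
rewrite /interior /=; apply: filterS (filterI nbhs_dom nbhs_chart).
by move=> y [c'y cy]; apply/overlapP.
Qed.

Lemma transition_image x : O x -> overlap c' c (phi x).
Proof.
move=> [p [cp c'p] <-]; exists p => //.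
by rewrite /transition coordK.
Qed.

Lemma transition_chart_image x : O x -> chart_image c' (phi x).
Proof. by move=> [p [cp c'p] <-]; exists p => //; rewrite /transition coordK. Qed.

Lemma transitionK x : O x -> transition c' c (phi x) = x.
Proof. by move=> [p [cp c'p] <-]; rewrite /transition !coordK. Qed.

Lemma smooth_transition j : smooth_on O (fun x => phi x ord0 j).
Proof. exact: transition_smooth. Qed.

Lemma smooth_jac k i : smooth_on O (fun x => J x k i).
Proof.
have -> : (fun x => J x k i) = pd i (fun y => phi y ord0 k).
  by apply/funext => x; rewrite mxE.
exact/smooth_pd/smooth_transition.
Qed.

Lemma pd_jacC i k l x : O x -> pd i (fun x => J x k l) x = pd l (fun x => J x k i) x.
Proof.
move=> Ox; have pdE i' l' : pd i' (fun x => J x k l') x = pd i' (pd l' (fun y => phi y ord0 k)) x.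
  by congr (pd _ _ _); apply/funext => y; rewrite mxE.
by rewrite !pdE (pd_pdC _ _ open_overlap (smooth_transition k) Ox).
Qed.

Lemma differentiable_transition j x : O x -> differentiable (fun y => phi y ord0 j) x.
Proof. exact/smooth_differentiable/smooth_transition. Qed.

Lemma pd_transition i (f : 'rV[R]_n -> R) x : O x -> differentiable f (phi x) ->
  differentiable (fun y => f (phi y)) x /\
  pd i (fun y => f (phi y)) x = \sum_(b < n) J x b i * pd b f (phi x).
Proof.
move=> Ox df; have [d ->] := pd_comp i (fun j => differentiable_transition j Ox) df.
by split => //; apply: eq_bigr => b _; rewrite mxE.
Qed.

End ChartChange.

Lemma pd_coord (R : realType) n (i l : 'I_n) (x : 'rV[R]_n) :
  pd i (fun y => y ord0 l) x = (l == i)%:R.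
Proof.
rewrite /pd deriveE; last exact: differentiable_coord.
have @f : {linear 'rV[R]_n -> R}.
  by exists (fun N : 'rV[R]_n => N ord0 l); do 2![eexists]; do ?[constructor];
     rewrite ?mxE// => ? *; rewrite ?mxE//; move=> ?; rewrite !mxE.
rewrite (_ : (fun y => _) = f) // diff_lin; last exact: coord_continuous.
by rewrite /f /= mxE eqxx.
Qed.

Section ChartChangeVolume.
Variables (R : realType) (n : nat) (M : smooth_manifold R n) (c c' : atlas M).
Local Notation O := (overlap c c').
Local Notation phi := (transition c c').
Local Notation J := (jac c c').

Lemma jacV x : O x -> jac c' c (phi x) *m J x = 1%:M.
Proof.
move=> Ox; apply/matrixP => l i; rewrite !mxE.
have d : differentiable (fun y => transition c' c y ord0 l) (phi x).
  exact: differentiable_transition (transition_image Ox).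
have [_ E] := pd_transition i Ox d.
have E' : pd i (fun y => transition c' c (phi y) ord0 l) x = pd i (fun y => y ord0 l) x.
  apply: near_eq_pd; apply: (open_near_eq (@open_overlap _ _ M c c') _ Ox) => y Oy.
  by rewrite transitionK.
rewrite -(pd_coord i l x) -E' E; apply: eq_bigr => k _; rewrite mulrC; congr (_ * _).
by rewrite [LHS]mxE.
Qed.

Lemma jac_det_neq0 x : O x -> \det (J x) != 0.
Proof.
move=> /jacV /(congr1 determinant); rewrite det_mulmx det1 => /eqP.
by apply: contraTneq => ->; rewrite mulr0 eq_sym oner_eq0.
Qed.

(** The logarithm of the density factor of weight 1. Density factors become exponentials of its
    multiples, so their products reduce to sums of weights. *)
Definition log_density (x : 'rV[R]_n) : R := ln `|\det (J x)| / n.+1%:R.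

Lemma density_factorE v x : O x -> density_factor v (J x) = expR (v * log_density x).
Proof.
move=> Ox; rewrite /density_factor /powR normr_eq0 (negbTE (jac_det_neq0 Ox)).
by rewrite /log_density mulrAC mulrA.
Qed.

Lemma differentiable_jac k i x : O x -> differentiable (fun y => J y k i) x.
Proof. by apply: smooth_differentiable; exact: smooth_jac. Qed.

Lemma pd_log_density x : O x ->
  differentiable log_density x /\
  forall a, pd a log_density x =
  \tr ((\matrix_(j, l) pd a (fun y => J y j l) x) *m jac c' c (phi x)) / n.+1%:R.
Proof.
move=> Ox; have dJ k i := differentiable_jac k i Ox.
have ddet : differentiable (fun y => \det (J y)) x.
  apply: differentiable_bigsum => s; apply: differentiable_mul; first exact: differentiable_cst.
  exact: differentiable_bigprod.
have pdln a := pd_comp1 a ddet (is_derive_ln_norm (jac_det_neq0 Ox)).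
have dln : differentiable ((fun t => ln `|t|) \o (fun y => \det (J y))) x.
  apply: differentiable_comp ddet _; apply/derivable1_diffP.
  by have [] := is_derive_ln_norm (jac_det_neq0 Ox).
have logE : log_density = fun y => n.+1%:R^-1 * ((fun t => ln `|t|) \o (fun y => \det (J y))) y.
  by apply/funext => y; rewrite /log_density mulrC.
split=> [|a]; first by rewrite logE; exact: differentiable_scale.
have [_ pdlna] := pdln a.
rewrite logE pdZ // pdlna mulrC pd_det //; congr (_ / _).
have adjE : \adj (J x) = \det (J x) *: jac c' c (phi x).
  rewrite -[LHS]mul1mx -(jacV Ox) -mulmxA mul_mx_adj.
  by rewrite mul_mx_scalar.
by rewrite adjE -scalemxAr mxtraceZ mulrA mulVf ?mul1r // jac_det_neq0.
Qed.

(** The trace of the transition law of the Christoffel symbols, after multiplication by the inverse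
    Jacobian. The inhomogeneous term becomes the logarithmic derivative of the Jacobian determinant,
    which division by [n + 1] turns into the derivative of [log_density]. *)
Lemma weight_form_transition (nab : connection M) a x : O x ->
  weight_form (nab c) a x =
  pd a log_density x + \sum_(b < n) J x b a * weight_form (nab c') b (phi x).
Proof.
move=> Ox; have [_ ->] := pd_log_density Ox.
pose dJ := \matrix_(j, l) pd a (fun y => J y j l) x.
pose S := \sum_(b < n) J x b a *: nab c' b (phi x).
have GE : J x *m nab c a x = dJ + S *m J x.
  apply/matrixP => l j; rewrite [LHS]mxE (christoffel_transition nab Ox) !mxE.
  congr (_ + _).
    by congr (pd _ _ _); apply/funext => y; rewrite mxE.
  under [RHS]eq_bigr do rewrite summxE big_distrl /=.
  rewrite [RHS]exchange_big; apply: eq_bigr => i _; apply: eq_bigr => k _.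
  by rewrite [in RHS]mxE; ring.
have GE' : nab c a x = jac c' c (phi x) *m (dJ + S *m J x).
  by rewrite -GE mulmxA jacV // mul1mx.
rewrite {1}/weight_form GE' mxtrace_mulC mulmxDl -mulmxA.
have -> : J x *m jac c' c (phi x) = 1%:M by apply: mulmx1C; exact: jacV.
rewrite mulmx1 linearD mulrDl; congr (_ + _).
rewrite linear_sum mulr_suml; apply: eq_bigr => b _.
by rewrite linearZ /= mulrA.
Qed.

(** The transition law of [weight_form] writes the derivative of [log_density] through connection
    forms and Jacobian entries, all differentiable. Second-order regularity thus follows without
    differentiating the determinant and the logarithm once more. *)
Lemma differentiable_pd_log_density (nab : connection M) e x : O x ->
  differentiable (pd e log_density) x.
Proof.
move=> Ox; pose g y := weight_form (nab c) e y
  - \sum_(l < n) J y l e * weight_form (nab c') l (phi y).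
apply: (@near_eq_differentiable _ _ _ g).
  apply: (open_near_eq (@open_overlap _ _ M c c') _ Ox) => y Oy.
  by rewrite /g (weight_form_transition nab e Oy) addrK.
apply: differentiable_add.
  exact: smooth_differentiable (smooth_weight_form nab e) (overlap_sub Ox).
apply: differentiable_opp; apply: differentiable_bigsum => l.
apply: differentiable_mul; first exact: differentiable_jac.
have d := smooth_differentiable (smooth_weight_form nab l) (transition_chart_image Ox).
by have [] := pd_transition e Ox d.
Qed.

Lemma pd_log_densityC (nab : connection M) a b x : O x ->
  pd a (pd b log_density) x = pd b (pd a log_density) x.
Proof.
move=> Ox; apply: schwarz; [|exact: differentiable_pd_log_density..].
apply: filterS (open_nbhs_nbhs (conj (@open_overlap _ _ M c c') Ox)) => y Oy.
by have [] := pd_log_density Oy.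
Qed.

End ChartChangeVolume.

(** * Tractors under changes of charts *)

Lemma lift0_mxE (R : realType) n (A : 'M[R]_n) :
  (lift0_mx A ord0 ord0 = 1) *
  (forall b, lift0_mx A ord0 (lift ord0 b) = 0) *
  (forall a, lift0_mx A (lift ord0 a) ord0 = 0) *
  (forall a b, lift0_mx A (lift ord0 a) (lift ord0 b) = A a b).
Proof. by rewrite /lift0_mx; do !split => *; rewrite block_mxE ?mxE. Qed.

Section ChartChangeTractors.
Variables (R : realType) (n : nat) (M : smooth_manifold R n) (c c' : atlas M).
Local Notation O := (overlap c c').
Local Notation phi := (transition c c').
Local Notation J := (jac c c').
Local Notation L := (log_density c c').

(* The Jacobian of the change of cone coordinates [s' = s * expR (- L x)], [x' = phi x]
   in the coframes [(ds, dx)], at [s = 1] and up to the factor [expR (- L x)] of [ds']. *)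
Definition cone_jac (x : 'rV[R]_n) : 'M[R]_n.+1 :=
  block_mx (1%:M : 'M[R]_1) (\row_(b < n) - pd b L x) 0 (J x).

Lemma cone_jacE x :
  (cone_jac x ord0 ord0 = 1) *
  (forall b, cone_jac x ord0 (lift ord0 b) = - pd b L x) *
  (forall a, cone_jac x (lift ord0 a) ord0 = 0) *
  (forall a b, cone_jac x (lift ord0 a) (lift ord0 b) = J x a b).
Proof. by rewrite /cone_jac; do !split => *; rewrite block_mxE ?mxE. Qed.

Lemma differentiable_cone_jac (nab : connection M) x A B : O x ->
  differentiable (fun y => cone_jac y A B) x.
Proof.
move=> Ox; elim/ord0_or_lift: A => [|a]; elim/ord0_or_lift: B => [|b];
  (under eq_fun do rewrite cone_jacE); try exact: differentiable_cst.
  by apply: differentiable_opp; exact: (differentiable_pd_log_density nab b Ox).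
exact: differentiable_jac.
Qed.

(** The nonconstant entries of the Jacobian are, up to sign, first derivatives of [log_density] and
    of the transition map, so this is the symmetry of second derivatives. It makes [cone_ext_pull]
    applicable with [N = 0]. *)
Lemma cone_pd_cone_jacC (nab : connection M) A E C x : O x ->
  cone_pd_mx A cone_jac x E C = cone_pd_mx C cone_jac x E A.
Proof.
move=> Ox; rewrite !mxE.
have S0 c0 E' : pd c0 (fun y => cone_jac y E' ord0) x = 0.
  rewrite (_ : (fun y => _) = fun=> (E' == ord0)%:R) ?pd_cst //.
  by apply/funext => y; elim/ord0_or_lift: E' => [|e]; rewrite cone_jacE.
elim/ord0_or_lift: A => [|a]; elim/ord0_or_lift: C => [|d].
- by [].
- by rewrite /cone_pd unlift_none liftK S0.
- by rewrite /cone_pd unlift_none liftK S0.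
rewrite /cone_pd !liftK; elim/ord0_or_lift: E => [|e].
  have pdE i l : pd i (fun y => cone_jac y ord0 (lift ord0 l)) x = - pd i (pd l L) x.
    rewrite -pdN; last exact: (differentiable_pd_log_density nab l Ox).
    by congr (pd _ _ _); apply/funext => y; rewrite cone_jacE.
  by rewrite !pdE (pd_log_densityC nab a d Ox).
have pdE i l : pd i (fun y => cone_jac y (lift ord0 e) (lift ord0 l)) x =
    pd i (fun y => J y e l) x.
  by congr (pd _ _ _); apply/funext => y; rewrite cone_jacE.
by rewrite !pdE pd_jacC.
Qed.

(** Naturality of the exterior derivative under the map of cones. A coefficient with [r] factors
    [ds'] carries [s' ^ (m - r)], and these factors contribute [expR (- r * L)]; at [s = 1] every
    component therefore receives the same factor [expR (- m * L)]. *)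
Lemma cone_ext_transition (nab : connection M) k m (T : 'rV[R]_n -> cotensor R n.+1 k) x I :
  O x -> (forall I, differentiable (fun y => T y I) (phi x)) ->
  cone_ext m (fun y I => expR (- m * L y) * pull (cone_jac y) (T (phi y)) I) x I =
  expR (- m * L x) * pull (cone_jac x) (cone_ext m T (phi x)) I.
Proof.
move=> Ox dT; have [dL _] := pd_log_density Ox.
pose F y : cotensor R n.+1 k := fun I => expR (- m * L y) * T (phi y) I.
have dTphi I' : differentiable (fun y => T (phi y) I') x.
  apply: differentiable_comp (dT I').
  by apply: differentiable_row => j; exact: differentiable_transition.
have dmL : differentiable (fun y => - m * L y) x by exact: differentiable_scale.
have dexp : differentiable (fun y => expR (- m * L y)) x.
  by apply: differentiable_comp dmL _; apply/derivable1_diffP; exact: derivable_expR.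
have pdexp a : pd a (fun y => expR (- m * L y)) x = expR (- m * L x) * (- m * pd a L x).
  by have [_ ->] := pd_comp1 a dmL (is_derive_expR _); rewrite pdZ.
have dF I' : differentiable (fun y => F y I') x by exact: differentiable_mul.
transitivity (cone_ext m (fun y => pull (cone_jac y) (F y)) x I).
  by congr (cone_ext m _ x I); apply/funext => y; apply/funext => I'; rewrite pullM.
rewrite (@cone_ext_pull _ _ _ _ _ (fun=> 0)) //; last 2 first.
- by move=> i j; exact: (differentiable_cone_jac nab).
- by move=> A E C; rewrite !addr0; exact: (cone_pd_cone_jacC nab).
rewrite /cone_ext pullM [RHS]mulrCA; congr (_ * _).
rewrite -alt_pull -altZ; apply: eq_alt => I'; rewrite pull_front /front.
rewrite ins0 subr0; set A := I' ord0; set K := [ffun i => _].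
(* Differentiating the exponential gives [- m * pd a L]: the entry [- pd a L] of the Jacobian times
   the derivative [m] in direction [ord0]. The chain rule accounts for the other rows. *)
have FE K' : cone_deriv m A F x K' =
    expR (- m * L x) * \sum_E cone_jac x E A * cone_deriv m E T (phi x) K'.
  rewrite big_ord_recl; under eq_bigr do rewrite cone_derivS.
  rewrite cone_deriv0; case: (unliftP ord0 A) => [a|] ->.
    have [_ pdT] := pd_transition a Ox (dT K').
    rewrite cone_derivS pdM // pdexp pdT cone_jacE.
    under [X in _ = _ * (_ + X)]eq_bigr do rewrite cone_jacE.
    by move: (\sum_(b < _) _) (expR _) (pd a L x) (T _ _) => q e p t; ring.
  rewrite cone_deriv0 big1 ?addr0 => [|i _]; last by rewrite cone_jacE mul0r.
  by rewrite cone_jacE mul1r /F mulrCA.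
rewrite (eq_pull _ FE) pullM; congr (_ * _).
rewrite /pull; under eq_bigr do rewrite big_distrr /=.
rewrite exchange_big; apply: eq_bigr => E _; rewrite big_distrr /=.
by apply: eq_bigr => K' _; rewrite mulrCA.
Qed.

(** The content lies in row [ord0] and column [lift ord0 b], where the equation is
    [weight_form_transition]. The two volume frames thereby convert the block-diagonal tractor
    transition into the Jacobian of the cone map. *)
Lemma tractor_transition_frame (nab : connection M) x : O x ->
  tractor_transition (J x) *m volume_frame nab c x =
  density_factor (- 1) (J x) *: (volume_frame nab c' (phi x) *m cone_jac x).
Proof.
move=> Ox; rewrite /tractor_transition -scalemxAl; congr (_ *: _).
apply/matrixP => A B; rewrite !mxE !big_ord_recl.
elim/ord0_or_lift: A => [|a]; elim/ord0_or_lift: B => [|b];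
  rewrite !lift0_mxE !splitting_changeE !cone_jacE ?(mul1r, mulr1, mul0r, add0r, addr0).
- by rewrite !big1 // => e _; rewrite ?cone_jacE ?lift0_mxE ?mulr0 ?mul0r.
- rewrite big1 ?addr0 => [|e _]; last by rewrite lift0_mxE mul0r.
  rewrite (weight_form_transition nab b Ox) opprD; congr (_ + _).
  by rewrite -sumrN; apply: eq_bigr => e _; rewrite splitting_changeE cone_jacE mulNr mulrC.
- by rewrite !big1 // => e _; rewrite ?cone_jacE ?splitting_changeE ?mulr0 ?mul0r.
- rewrite (bigD1 b) //= [RHS](bigD1 a) //= !big1 => [|e /negbTE neq_e|e /negbTE neq_e].
  + by rewrite !lift0_mxE !splitting_changeE !cone_jacE !eqxx mulr1 mul1r.
  + by rewrite splitting_changeE eq_sym neq_e mul0r.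
  + by rewrite splitting_changeE neq_e mulr0.
Qed.

(** The density factor of weight [- w] and one factor of weight [- 1] for each of the [k] slots
    combine to the exponent [- (w + k)]. *)
Lemma pull_transition (nab : connection M) k w (T : cotensor R n.+1 k) x I : O x ->
  pull (volume_frame nab c x)
    (fun I => density_factor (- w) (J x) * pull (tractor_transition (J x)) T I) I =
  expR (- (w + k%:R) * L x) *
    pull (cone_jac x) (pull (volume_frame nab c' (phi x)) T) I.
Proof.
move=> Ox; rewrite pullM !pull_mul tractor_transition_frame // pullZ mulrA.
congr (_ * _); rewrite !density_factorE // -expRM_natl -expRD.
by congr expR; ring.
Qed.

End ChartChangeTractors.

(** * Invariance of the operator and vanishing of its square *)

Section TractorForms.
Variables (R : realType) (n : nat) (M : smooth_manifold R n).

Lemma volume_frame_inj (nab : connection M) c k (T T' : cotensor R n.+1 k) x :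
  pull (volume_frame nab c x) T =1 pull (volume_frame nab c x) T' -> T =1 T'.
Proof. exact/pull_inj/splitting_changeVr. Qed.

Lemma smooth_volume_frame (nab : connection M) c i j :
  smooth_on (chart_image c) (fun y => volume_frame nab c y i j).
Proof.
elim/ord0_or_lift: i => [|a]; elim/ord0_or_lift: j => [|b];
  (under eq_fun do rewrite splitting_changeE); try exact: smooth_cst.
by apply: smoothN; [exact: chart_image_open|exact: smooth_weight_form].
Qed.

(** Both sides are compared in the volume frame of [c], where the transition law becomes that of
    homogeneous forms on the cone. Weight [w - 1] at rank [k.+1] yields the same exponent as weight
    [w] at rank [k]. *)
Lemma scrD_transition (nab : connection M) k w (F : tractor_field M k) : (2 <= n)%N ->
  (forall c, smooth_cotensor (chart_image c) (F nab c)) ->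
  (forall c c' x, overlap c c' x -> forall I, F nab c x I =
     density_factor (- w) (jac c c' x)
     * pull (tractor_transition (jac c c' x)) (F nab c' (transition c c' x)) I) ->
  forall c c' x, overlap c c' x -> forall I, scrD w F nab c x I =
     density_factor (- (w - 1)) (jac c c' x)
     * pull (tractor_transition (jac c c' x)) (scrD w F nab c' (transition c c' x)) I.
Proof.
move=> n_ge2 sF trF c c' x Ox; apply: (@volume_frame_inj nab c _ _ _ x) => I.
have cx := overlap_sub Ox; have c'x := transition_chart_image Ox.
rewrite pull_transition // scrD_cone_ext //.
pose T y := pull (volume_frame nab c' y) (F nab c' y).
have dT J : differentiable (fun y => T y J) (transition c c' x).
  apply: smooth_differentiable c'x; apply: smooth_pull => //.
    exact: chart_image_open.
  exact: smooth_volume_frame.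
transitivity (cone_ext (w + k%:R) (fun y I => expR (- (w + k%:R) * log_density c c' y) *
    pull (cone_jac c c' y) (T (transition c c' y)) I) x I).
  apply: near_eq_cone_ext => J; apply: (open_near_eq (@open_overlap _ _ M c c') _ Ox) => y Oy.
  by rewrite -pull_transition //; apply: eq_pull => K; exact: trF.
rewrite (cone_ext_transition nab _ _ Ox dT).
have -> : w - 1 + k.+1%:R = w + k%:R by rewrite -natr1; ring.
congr (_ * _).
by apply: eq_pull => K; rewrite (scrD_cone_ext _ _ n_ge2 (sF c') c'x).
Qed.

(** On coordinate fields, the trace of the change contains [U_a] once for each of the [n] diagonal
    entries and once more from the Kronecker term. The total [(n + 1) U_a] is divided by the [n + 1]
    of the density normalisation. *)
Lemma weight_form_projective_change (nab nab' : connection M) U c a x :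
  projective_change nab nab' U -> chart_image c x ->
  weight_form (nab' c) a x = U c x [ffun=> a] + weight_form (nab c) a x.
Proof.
move=> [_ chg] cx.
have GE e : nab' c a x e e = nab c a x e e + U c x [ffun=> e] * (a == e)%:R + U c x [ffun=> a].
  have := chg c (fun _ l => (l == e)%:R) (fun b => @smooth_cst _ _ _ _) x cx a e.
  have vE (nab0 : connection M) : vcov (nab0 c) (fun (_ : 'rV_n) (l : 'I_n) => (l == e)%:R) a e x =
      nab0 c a x e e.
    rewrite /vcov pd_cst add0r (bigD1 e) //= eqxx mulr1.
    by rewrite big1 ?addr0 // => l /negbTE ->; rewrite mulr0.
  rewrite !vE eqxx mulr1 => ->; congr (_ + _ * _ + _).
  rewrite (bigD1 e) //= eqxx mulr1 big1 ?addr0 // => l /negbTE ->; by rewrite mulr0.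
rewrite /weight_form /mxtrace; under eq_bigr do rewrite GE.
have -> : \sum_(e < n) (nab c a x e e + U c x [ffun=> e] * (a == e)%:R + U c x [ffun=> a]) =
    \sum_(e < n) nab c a x e e + U c x [ffun=> a] * n.+1%:R.
  rewrite !big_split /= sumr_const card_ord -addrA mulr_natr mulrS; congr (_ + (_ + _)).
  rewrite (bigD1 a) //= eqxx mulr1 big1 ?addr0 // => l.
  by rewrite eq_sym => /negbTE ->; rewrite mulr0.
by rewrite mulrDl mulfK ?pnatr_eq0 // addrC.
Qed.

(** The change of splitting times the volume frame of [nab] is the volume frame of [nab']. In these
    frames the two connections therefore present the same tensor to [cone_ext], which mentions no
    connection. *)
Lemma scrD_projective_change (nab nab' : connection M) U k w (F : tractor_field M k) c :
  (2 <= n)%N -> projective_change nab nab' U ->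
  smooth_cotensor (chart_image c) (F nab c) ->
  smooth_cotensor (chart_image c) (F nab' c) ->
  (forall x, chart_image c x -> forall I,
     F nab c x I = pull (splitting_change (fun b => U c x [ffun=> b])) (F nab' c x) I) ->
  forall x, chart_image c x -> forall I, scrD w F nab c x I =
    pull (splitting_change (fun b => U c x [ffun=> b])) (scrD w F nab' c x) I.
Proof.
move=> n_ge2 chg sF sF' trF x cx; apply: (@volume_frame_inj nab c _ _ _ x) => I.
have frameE y : chart_image c y ->
    splitting_change (fun b => U c y [ffun=> b]) *m volume_frame nab c y = volume_frame nab' c y.
  move=> cy; rewrite splitting_changeM; congr splitting_change; apply/funext => b.
  by rewrite (weight_form_projective_change b chg cy).
rewrite pull_mul frameE // !scrD_cone_ext //.
apply: near_eq_cone_ext => J; apply: (open_near_eq (@chart_image_open _ _ M c) _ cx) => y cy.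
by rewrite -(frameE y cy) -pull_mul; apply: eq_pull => K; exact: trF.
Qed.

Lemma scrD_scrD (nab : connection M) c k w (F : tractor_field M k) x I :
  (2 <= n)%N -> smooth_cotensor (chart_image c) (F nab c) -> chart_image c x ->
  scrD (w - 1) (scrD w F) nab c x I = 0.
Proof.
move=> n_ge2 sF cx; pose Z : cotensor R n.+1 k.+2 := fun=> 0.
suff : scrD (w - 1) (scrD w F) nab c x =1 Z by [].
apply: (@volume_frame_inj nab c _ _ _ x) => J.
rewrite [RHS]/pull big1 => [|K _]; last by rewrite mulr0.
rewrite scrD_cone_ext //; last exact: smooth_scrD.
have -> : w - 1 + k.+1%:R = w + k%:R by rewrite -natr1; ring.
pose T y := pull (volume_frame nab c y) (F nab c y).
rewrite -(@cone_ext_ext _ _ _ (chart_image c) (w + k%:R) T x J) //; last 2 first.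
- exact: chart_image_open.
- by apply: smooth_pull => //; [exact: chart_image_open|exact: smooth_volume_frame].
(* The inner operator is replaced on a whole neighbourhood, because the outer one differentiates
   it. *)
apply: near_eq_cone_ext => K; apply: (open_near_eq (@chart_image_open _ _ M c) _ cx) => y cy.
exact: scrD_cone_ext.
Qed.

Lemma tractor_form_scrD (p : set (connection M)) k w (F : tractor_field M k) :
  (2 <= n)%N -> tractor_form p w F -> tractor_form p (w - 1) (scrD w F).
Proof.
move=> n_ge2 [sF skF trF chgF]; split.
- move=> nab pnab c I; apply: smooth_scrD => J; exact: sF.
- move=> nab pnab c x cx s I.
  by rewrite /scrD skew_alt mulrCA.
- move=> nab pnab; apply: scrD_transition => //; first by move=> c I; exact: sF.
  exact: trF.
- move=> nab nab' U pnab pnab' chg c; apply: scrD_projective_change => //.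
  + by move=> I; exact: sF.
  + by move=> I; exact: sF.
  + exact: chgF.
Qed.

End TractorForms.

(** * Skew tensors and their column components *)

Section SkewTensors.
Variables (R : realType) (d : nat).
Local Notation index k := {ffun 'I_k -> 'I_d}.

Lemma skew_fcons k (T : cotensor R d k.+1) a :
  Defs.skew T -> Defs.skew (fun J => T (fcons a J)).
Proof.
move=> skT s J; have := skT (lift_perm ord0 ord0 s) (fcons a J).
rewrite odd_lift_perm addbb addFb => <-; congr (T _); apply/ffunP => i; rewrite [RHS]ffunE.
by case: (unliftP ord0 i) => [j|] ->; rewrite ?lift_perm_id ?lift_perm_lift ?fcons0 ?fconsS ?ffunE.
Qed.

Lemma skew_move_front k (T : cotensor R d k.+1) (I : index k.+1) i : Defs.skew T ->
  T (fcons (I i) [ffun j => I (lift i j)]) = (-1) ^+ i * T I.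
Proof.
move=> skT; have := skT (lift_perm ord0 i 1%g) I.
rewrite odd_lift_perm odd_perm1 addbF addFb signr_odd => <-.
congr (T _); apply/ffunP => j; rewrite [RHS]ffunE.
by case: (unliftP ord0 j) => [l|] ->;
  rewrite ?lift_perm_id ?lift_perm_lift ?fcons0 ?fconsS ?ffunE ?perm1.
Qed.

Lemma skew_repeated k (T : cotensor R d k) (I : index k) i j : Defs.skew T ->
  i != j -> I i = I j -> T I = 0.
Proof.
move=> skT neq_ij eqI; have := skT (tperm i j) I.
rewrite (_ : [ffun l => _] = I) => [|]; last first.
  by apply/ffunP => l; rewrite ffunE; case: tpermP => [->|->|].
rewrite odd_tperm neq_ij expr1 mulN1r => /eqP.
by rewrite -subr_eq0 opprK -mulr2n mulrn_eq0 => /eqP.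
Qed.

Lemma pull_fcons k (A : 'M[R]_d) (T : cotensor R d k.+1) a I :
  pull A T (fcons a I) = \sum_e A e a * pull A (fun J => T (fcons e J)) I.
Proof.
rewrite -[RHS](frontE (fun a J => \sum_e A e a * pull A (fun J => T (fcons e J)) J)).
rewrite -pull_front; apply: eq_pull => J.
by rewrite -{1}[J]fcons_eta.
Qed.

Lemma pull_rank0 (A : 'M[R]_d) (T : cotensor R d 0) I : pull A T I = T I.
Proof.
rewrite /pull (big_pred1 I) ?big_ord0 ?mul1r // => K.
by apply/esym/eqP/ffunP => -[].
Qed.

End SkewTensors.

Section Columns.
Variables (R : realType) (n : nat).

Definition lift_index k (I : {ffun 'I_k -> 'I_n}) : {ffun 'I_k -> 'I_n.+1} :=
  [ffun i => lift ord0 (I i)].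

Definition Ycomp k (T : cotensor R n.+1 k.+1) : cotensor R n k :=
  fun I => T (fcons ord0 (lift_index I)).

Definition Zcomp k (T : cotensor R n.+1 k) : cotensor R n k :=
  fun I => T (lift_index I).

Lemma lift_index_fcons k a (I : {ffun 'I_k -> 'I_n}) :
  lift_index (fcons a I) = fcons (lift ord0 a) (lift_index I).
Proof.
apply/ffunP => i; case: (unliftP ord0 i) => [j|] ->;
by rewrite ?ffunE ?fcons0 ?fconsS ?liftK ?unlift_none ?ffunE.
Qed.

Lemma lift_index_subst k (I : {ffun 'I_k -> 'I_n}) i e :
  lift_index (subst_index I i e) = subst_index (lift_index I) i (lift ord0 e).
Proof. by apply/ffunP => j; rewrite !ffunE; case: eqP. Qed.

Lemma subst_fconsS k (a : 'I_n.+1) (I : {ffun 'I_k -> 'I_n.+1}) i e :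
  subst_index (fcons a I) (lift ord0 i) e = fcons a (subst_index I i e).
Proof.
apply/ffunP => j; rewrite [LHS]ffunE; case: (unliftP ord0 j) => [l|] ->.
  by rewrite !fconsS ffunE (inj_eq (@lift_inj _ _)).
by rewrite !fcons0 (negbTE (neq_lift _ _)).
Qed.

Lemma subst_fcons0 k (a : 'I_n.+1) (I : {ffun 'I_k -> 'I_n.+1}) e :
  subst_index (fcons a I) ord0 e = fcons e I.
Proof.
apply/ffunP => j; rewrite [LHS]ffunE; case: (unliftP ord0 j) => [l|] ->.
  by rewrite !fconsS eq_sym (negbTE (neq_lift _ _)).
by rewrite !fcons0 eqxx.
Qed.

Lemma skew_Zcomp k (T : cotensor R n.+1 k) : Defs.skew T -> Defs.skew (Zcomp T).
Proof.
by move=> skT s I; rewrite /Zcomp -skT; congr T; apply/ffunP => i; rewrite !ffunE.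
Qed.

Lemma skew_Ycomp k (T : cotensor R n.+1 k.+1) : Defs.skew T -> Defs.skew (Ycomp T).
Proof. by move=> /(skew_fcons ord0)/skew_Zcomp. Qed.

(** A tuple without [ord0] is read off by [Zcomp]. A single [ord0] can be moved to the front, where
    [Ycomp] reads the value, and two occurrences force the value zero. *)
Lemma skew_ext k (T T' : cotensor R n.+1 k.+1) : Defs.skew T -> Defs.skew T' ->
  Ycomp T =1 Ycomp T' -> Zcomp T =1 Zcomp T' -> T =1 T'.
Proof.
move=> skT skT' eqt eqb A.
have lifted l (B : {ffun 'I_l -> 'I_n.+1}) : (forall i, B i != ord0) -> exists I, B = lift_index I.
  move=> B0; have B0' i : ord0 != B i by rewrite eq_sym.
  exists [ffun i => s2val (unlift_some (B0' i))].
  by apply/ffunP => i; rewrite !ffunE -(s2valP (unlift_some (B0' i))).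
case: (pickP (fun i => A i == ord0)) => [i /eqP Ai0|A0]; last first.
  by have [I ->] := lifted _ A (fun i => negbT (A0 i)); exact: eqb.
have := skew_move_front A i skT; have := skew_move_front A i skT'.
rewrite Ai0; set B := [ffun j => _] => ET' ET.
suff TB : T (fcons ord0 B) = T' (fcons ord0 B).
  by apply: (@mulfI _ ((-1) ^+ i)); rewrite ?signr_eq0 // -ET -ET'.
case: (pickP (fun j => B j == ord0)) => [j /eqP Bj0|B0].
  have neq : ord0 != lift ord0 j by exact: neq_lift.
  by rewrite !(skew_repeated _ neq) ?fcons0 ?fconsS.
by have [I ->] := lifted _ B (fun i => negbT (B0 i)); exact: eqt.
Qed.

(** The term of the column notation built from [Z] factors alone, that is, the extension of [xi] by
    zero in the direction [ord0]. *)
Definition pad k (xi : cotensor R n k) : cotensor R n.+1 k := fun A =>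
  \sum_(a : {ffun 'I_k -> 'I_n}) xi a * \prod_(i < k) tZ R (a i) (A i).

Lemma skew_pad k (xi : cotensor R n k) : Defs.skew xi -> Defs.skew (pad xi).
Proof.
move=> skxi s A; rewrite /pad big_distrr /=.
rewrite (reindex (fun a : {ffun 'I_k -> 'I_n} => [ffun i => a (s i)])) /=; last first.
  exists (fun a : {ffun 'I_k -> 'I_n} => [ffun i => a (s^-1%g i)]) => a _;
    by apply/ffunP => i; rewrite !ffunE ?permK ?permKV.
apply: eq_bigr => a _; rewrite skxi mulrA; congr (_ * _).
rewrite [RHS](reindex_inj (@perm_inj _ s)) /=.
by apply: eq_bigr => i _; rewrite !ffunE.
Qed.

Lemma pad_lift k (xi : cotensor R n k) I : pad xi (lift_index I) = xi I.
Proof.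
rewrite -[RHS]pull1 /pull /pad; apply: eq_bigr => a _; rewrite mulrC; congr (_ * _).
apply: eq_bigr => i _; rewrite ffunE mxE /tZ.
by rewrite (inj_eq (@lift_inj _ _)) eq_sym.
Qed.

Lemma pad0 k (xi : cotensor R n k) (A : {ffun 'I_k -> 'I_n.+1}) i : A i = ord0 -> pad xi A = 0.
Proof.
move=> Ai0; rewrite /pad big1 // => a _; rewrite (bigD1 i) //= Ai0 /tZ.
by rewrite (negbTE (neq_lift _ _)) mul0r mulr0.
Qed.

(** The [Z] factors contracted with [mu] are already skew, so the factor [k.+1] of the column
    notation turns the alternation into a signed sum over the position of [Y]. *)
Lemma columnE k (mu : cotensor R n k) (xi : cotensor R n k.+1) A : Defs.skew mu ->
  column mu xi A =
  \sum_(i < k.+1) (-1) ^+ i * (tY R (A i) * pad mu [ffun j => A (lift i j)]) + pad xi A.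
Proof.
move=> skmu; rewrite /column; congr (_ + _).
rewrite -(@alt_front_skew _ _ _ (fun A0 A' => tY R A0 * pad mu A')); last first.
  by move=> a s I; rewrite skew_pad // mulrCA.
congr (_ * _); apply: eq_alt; apply: eq_front => A0 A'.
by rewrite /pad big_distrr /=; apply: eq_bigr => a _; rewrite mulrAC mulrC mulrA.
Qed.

Lemma Zcomp_column k (mu : cotensor R n k) (xi : cotensor R n k.+1) : Defs.skew mu ->
  Zcomp (column mu xi) =1 xi.
Proof.
move=> skmu I; rewrite /Zcomp columnE // pad_lift big1 ?add0r // => i _.
by rewrite ffunE tYS mul0r mulr0.
Qed.

Lemma Ycomp_column k (mu : cotensor R n k) (xi : cotensor R n k.+1) : Defs.skew mu ->
  Ycomp (column mu xi) =1 mu.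
Proof.
move=> skmu I; rewrite /Ycomp columnE // (@pad0 _ _ _ ord0) ?fcons0 // addr0.
rewrite big_ord_recl big1 ?addr0 => [|i _]; last by rewrite fconsS ffunE tYS mul0r mulr0.
rewrite fcons0 tY0 !mul1r -[RHS]pad_lift; congr pad.
by apply/ffunP => j; rewrite ffunE fconsS.
Qed.

Lemma skew_column k (mu : cotensor R n k) (xi : cotensor R n k.+1) :
  Defs.skew mu -> Defs.skew xi -> Defs.skew (column mu xi).
Proof.
move=> skmu skxi s A; rewrite /column skew_alt -/(pad xi _) (skew_pad skxi).
by rewrite mulrDr mulrCA.
Qed.

(** A block-diagonal change of frame does not mix the direction [ord0] with the others; the
    induction peels off one slot at a time. *)
Lemma pull_lift0_Zcomp k (J : 'M[R]_n) (T : cotensor R n.+1 k) I :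
  Zcomp (pull (lift0_mx J) T) I = pull J (Zcomp T) I.
Proof.
elim: k T I => [|k IH] T I; first by rewrite /Zcomp !pull_rank0.
rewrite -[I]fcons_eta /Zcomp lift_index_fcons !pull_fcons big_ord_recl lift0_mxE mul0r add0r.
apply: eq_bigr => e _; rewrite lift0_mxE; congr (_ * _).
rewrite -[LHS]/(Zcomp _ _) IH; apply: eq_pull => K.
by rewrite /Zcomp lift_index_fcons.
Qed.

Lemma pull_lift0_Ycomp k (J : 'M[R]_n) (T : cotensor R n.+1 k.+1) I :
  Ycomp (pull (lift0_mx J) T) I = pull J (Ycomp T) I.
Proof.
rewrite /Ycomp pull_fcons big_ord_recl lift0_mxE mul1r big1 ?addr0.
  exact: (pull_lift0_Zcomp J (fun K => T (fcons ord0 K))).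
by move=> e _; rewrite lift0_mxE mul0r.
Qed.

End Columns.

(** * Tractor derivatives in components and the column formula *)

Lemma skew_cov (R : realType) n d k (O : set 'rV[R]_n) (A : 'I_n -> 'rV[R]_n -> 'M[R]_d) th w
    (T : 'rV[R]_n -> cotensor R d k) a x :
  open O -> (forall y, O y -> Defs.skew (T y)) -> smooth_cotensor O T -> O x ->
  Defs.skew (cov A th w T a x).
Proof.
move=> oO skT sT Ox s I; rewrite /cov mulrBr mulrDr; congr (_ + _ - _).
- rewrite -pdZ; last exact: smooth_differentiable (sT I) Ox.
  by apply: near_eq_pd; apply: (open_near_eq oO _ Ox) => y Oy; rewrite skT.
- by rewrite skT // mulrCA.
- rewrite big_distrr /= [RHS](reindex_inj (@perm_inj _ s)) /=.
  apply: eq_bigr => i _; rewrite big_distrr /=; apply: eq_bigr => e _.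
  rewrite ffunE mulrCA -skT //; congr (_ * T _ _).
  by apply/ffunP => j; rewrite !ffunE (inj_eq (@perm_inj _ s)).
Qed.

Lemma eq_cov (R : realType) n d k (O : set 'rV[R]_n) (A : 'I_n -> 'rV[R]_n -> 'M[R]_d) th w
    (T T' : 'rV[R]_n -> cotensor R d k) a x :
  open O -> (forall y, O y -> T y =1 T' y) -> O x ->
  cov A th w T a x =1 cov A th w T' a x.
Proof.
move=> oO TT' Ox I; rewrite /cov TT' //; congr (_ + _ - _).
  by apply: near_eq_pd; apply: (open_near_eq oO _ Ox) => y Oy; rewrite TT'.
by apply: eq_bigr => i _; apply: eq_bigr => e _; rewrite TT'.
Qed.

Section ColumnFormula.
Variables (R : realType) (n : nat) (M : smooth_manifold R n).
Variables (nab : connection M) (c : atlas M).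
Local Notation O := (chart_image c).

Lemma tractor_conn_matrixE a x :
  (tractor_conn_matrix (nab c) a x ord0 ord0 = - weight_form (nab c) a x) *
  (forall d, tractor_conn_matrix (nab c) a x ord0 (lift ord0 d) = - schouten (nab c) a d x) *
  (forall e, tractor_conn_matrix (nab c) a x (lift ord0 e) ord0 = (e == a)%:R) *
  (forall e d, tractor_conn_matrix (nab c) a x (lift ord0 e) (lift ord0 d) =
     nab c a x e d - (weight_form (nab c) a x)%:M e d).
Proof. by rewrite /tractor_conn_matrix; do !split => *; rewrite block_mxE ?mxE ?eqxx. Qed.

Let th a x := weight_form (nab c) a x.
Let conn := tractor_conn_matrix (nab c).

(** The scalar part [- th a] of the connection matrix, taken over [k.+1] slots, raises the weight to
    [k.+1 + w]. The Schouten entry places [ord0] in slot [i]; moving it to the front costs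
    [(-1) ^+ i], the sign of the expanded alternation. *)
Lemma Zcomp_tractor_cov k w (T : 'rV[R]_n -> cotensor R n.+1 k.+1) a x I :
  Defs.skew (T x) ->
  Zcomp (cov conn th w T a x) I =
  cov (nab c) th (k.+1%:R + w) (fun y => Zcomp (T y)) a x I
  + k.+1%:R * alt (front (fun b J => schouten (nab c) a b x * Ycomp (T x) J)) I.
Proof.
move=> skT; rewrite alt_front_skew; last first.
  by move=> b s J; rewrite (skew_Ycomp skT) mulrCA.
have E : \sum_(i < k.+1) \sum_(e < n.+1) conn a x e (lift_index I i) *
      T x (subst_index (lift_index I) i e) =
    \sum_(i < k.+1) \sum_(e < n) nab c a x e (I i) * Zcomp (T x) (subst_index I i e)
    - k.+1%:R * th a x * Zcomp (T x) I
    - \sum_(i < k.+1) (-1) ^+ i * (schouten (nab c) a (I i) x *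
        Ycomp (T x) [ffun j => I (lift i j)]).
  rewrite -(sum_subst_scalar (th a x)) -!sumrB; apply: eq_bigr => i _.
  rewrite big_ord_recl ffunE tractor_conn_matrixE addrC -sumrB; congr (_ + _).
    apply: eq_bigr => e _; rewrite tractor_conn_matrixE -mulrBl; congr (_ * _).
    by rewrite /Zcomp lift_index_subst.
  rewrite mulNr mulrCA; congr (- (_ * _)).
  have := skew_move_front (subst_index (lift_index I) i ord0) i skT.
  rewrite ffunE eqxx => E; apply: (@mulfI _ ((-1) ^+ i)); first by rewrite signr_eq0.
  rewrite -E mulrA -expr2 sqrr_sign mul1r /Ycomp; congr (T x (fcons _ _)).
  by apply/ffunP => j; rewrite !ffunE eq_sym (negbTE (neq_lift _ _)).
rewrite {1}/Zcomp {1}/cov E -/(Zcomp (T x) I) [in RHS]/cov.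
rewrite -[pd a (fun y => T y _) x]/(pd a (fun y => Zcomp (T y) I) x).
set s1 := \sum_(i < k.+1) \sum_(e < n) nab c a x e (I i) * Zcomp (T x) (subst_index I i e).
set s2 := \sum_(i < k.+1) (-1) ^+ i * (schouten (nab c) a (I i) x *
  Ycomp (T x) [ffun j => I (lift i j)]).
by move: (pd _ _ _) s1 s2 (Zcomp _ _) (th _ _) => p s1 s2 b t; ring.
Qed.

(** In the front slot the diagonal entry contributes one unit to the weight shift, and the Kronecker
    entry replaces [ord0] by [a], which yields the term in [Zcomp]. In the other slots the Schouten
    entry would create a second [ord0] and vanishes by skewness. *)
Lemma Ycomp_tractor_cov k w (T : 'rV[R]_n -> cotensor R n.+1 k.+1) a x I :
  Defs.skew (T x) ->
  Ycomp (cov conn th w T a x) I =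
  cov (nab c) th (k.+1%:R + w) (fun y => Ycomp (T y)) a x I - Zcomp (T x) (fcons a I).
Proof.
move=> skT.
have E : \sum_(i < k.+1) \sum_(e < n.+1) conn a x e (fcons ord0 (lift_index I) i) *
      T x (subst_index (fcons ord0 (lift_index I)) i e) =
    \sum_(i < k) \sum_(e < n) nab c a x e (I i) * Ycomp (T x) (subst_index I i e)
    - k%:R * th a x * Ycomp (T x) I - th a x * Ycomp (T x) I + Zcomp (T x) (fcons a I).
  rewrite big_ord_recl big_ord_recl fcons0 tractor_conn_matrixE subst_fcons0 -/(Ycomp (T x) I).
  have -> : \sum_(e < n) conn a x (lift ord0 e) ord0 *
      T x (subst_index (fcons ord0 (lift_index I)) ord0 (lift ord0 e)) =
      Zcomp (T x) (fcons a I).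
    rewrite (bigD1 a) //= tractor_conn_matrixE eqxx mul1r big1 ?addr0.
      by rewrite subst_fcons0 /Zcomp lift_index_fcons.
    by move=> e /negbTE neq_e; rewrite tractor_conn_matrixE neq_e mul0r.
  have -> : \sum_(i < k) \sum_(e < n.+1) conn a x e (fcons ord0 (lift_index I) (lift ord0 i)) *
      T x (subst_index (fcons ord0 (lift_index I)) (lift ord0 i) e) =
      \sum_(i < k) \sum_(e < n) nab c a x e (I i) * Ycomp (T x) (subst_index I i e)
      - k%:R * th a x * Ycomp (T x) I.
    rewrite -(sum_subst_scalar (th a x)) -sumrB; apply: eq_bigr => i _.
    rewrite big_ord_recl fconsS subst_fconsS.
    have neq : ord0 != lift ord0 i by exact: neq_lift.
    rewrite (skew_repeated skT neq) ?fcons0 ?fconsS ?ffunE ?eqxx // mulr0 add0r -sumrB.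
    apply: eq_bigr => e _; rewrite tractor_conn_matrixE -mulrBl; congr (_ * _).
    by rewrite subst_fconsS -lift_index_subst.
  set s1 := \sum_(i < k) \sum_(e < n) _.
  by rewrite -/(th a x); move: s1 (Zcomp _ _) (Ycomp _ _) (th _ _) => s1 b u t; ring.
rewrite {1}/Ycomp {1}/cov E -/(Ycomp (T x) I) [in RHS]/cov.
rewrite -[in RHS]natr1.
rewrite -[pd a (fun y => T y _) x]/(pd a (fun y => Ycomp (T y) I) x).
set s1 := \sum_(i < k) \sum_(e < n) nab c a x e (I i) * Ycomp (T x) (subst_index I i e).
by move: (pd _ _ _) s1 (Zcomp _ _) (Ycomp _ _) (th _ _) => p s1 b u t; ring.
Qed.

Lemma scrD_expand k w (F : tractor_field M k) x A :
  (forall y, O y -> Defs.skew (F nab c y)) -> smooth_cotensor O (F nab c) -> O x ->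
  scrD w F nab c x A =
  \sum_(i < k.+1) (-1) ^+ i * (w * tY R (A i) * F nab c x [ffun j => A (lift i j)]
    + \sum_(a < n) tZ R a (A i) * tractor_cov w F nab c a x [ffun j => A (lift i j)]).
Proof.
move=> skF sF Ox; rewrite /scrD /thomas alt_front_skew //.
have oO : open O by exact: chart_image_open.
move=> B s I; rewrite mulrDr; congr (_ + _); first by rewrite (skF x Ox) mulrCA.
rewrite big_distrr /=; apply: eq_bigr => a _.
by rewrite /tractor_cov (skew_cov _ _ _ _ oO skF sF Ox) mulrCA.
Qed.

(** With [ord0] in front, the term [i = 0] of the expansion gives [w] times [Zcomp]. Each of the
    [k.+1] others adds one more [Zcomp], from the tractor derivative of [Y]: the minus sign there
    meets the shift of position by one. Hence the coefficient [w + k.+1]. *)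
Lemma Ycomp_scrD k w (F : tractor_field M k.+1) x I :
  (forall y, O y -> Defs.skew (F nab c y)) -> smooth_cotensor O (F nab c) -> O x ->
  Ycomp (scrD w F nab c x) I = (w + k.+1%:R) * Zcomp (F nab c x) I
  - k.+1%:R * alt (front (fun a => cov (nab c) th (k.+1%:R + w)
      (fun y => Ycomp (F nab c y)) a x)) I.
Proof.
move=> skF sF Ox; rewrite {1}/Ycomp scrD_expand // big_ord_recl fcons0 tY0 mulr1 mul1r.
rewrite sum_tZ unlift_none addr0 alt_front_skew; last first.
  move=> a; apply: (skew_cov _ _ _ _ (@chart_image_open _ _ M c)) Ox => [y Oy|J].
    exact/skew_Ycomp/skF.
  exact: sF.
have tail0 : [ffun j => fcons ord0 (lift_index I) (lift ord0 j)] = lift_index I.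
  by apply/ffunP => j; rewrite ffunE fconsS.
rewrite tail0 -/(Zcomp (F nab c x) I) mulrDl -addrA; congr (_ + _).
have -> : k.+1%:R * Zcomp (F nab c x) I = \sum_(i < k.+1) Zcomp (F nab c x) I.
  by rewrite sumr_const card_ord mulr_natl.
rewrite -sumrB; apply: eq_bigr => i _.
rewrite fconsS ffunE tYS mulr0 mul0r add0r sum_tZ liftK.
have -> : [ffun j => fcons ord0 (lift_index I) (lift (lift ord0 i) j)] =
    fcons ord0 (lift_index [ffun j => I (lift i j)]).
  apply/ffunP => j; rewrite [LHS]ffunE; case: (unliftP ord0 j) => [l|] ->.
    rewrite fconsS !ffunE; set e := lift _ _.
    have -> : e = lift ord0 (lift i l).
      by apply: val_inj; rewrite /= /bump !leq0n !add1n ltnS addnS.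
    by rewrite liftK !ffunE.
  rewrite fcons0; set e := lift _ _.
  have -> : e = ord0 by apply: val_inj.
  by rewrite fcons0.
rewrite -/(Ycomp _ _) /tractor_cov Ycomp_tractor_cov; last exact: skF.
rewrite (skew_move_front I i (skew_Zcomp (skF x Ox))) lift0 exprS mulN1r.
by rewrite mulNr mulrBr mulrA -expr2 sqrr_sign mul1r opprB.
Qed.

(** In [(k.+2)! / k!] the factor [k.+2] is the normalisation of [scrD] and the factor [k.+1] comes
    from the Schouten term of [Zcomp_tractor_cov]. The nested alternations merge by
    [alt_front_alt]. *)
Lemma Zcomp_scrD k w (F : tractor_field M k.+1) x I :
  (forall y, O y -> Defs.skew (F nab c y)) -> smooth_cotensor O (F nab c) -> O x ->
  Zcomp (scrD w F nab c x) I =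
  k.+2%:R * alt (front (fun a => cov (nab c) th (k.+1%:R + w)
      (fun y => Zcomp (F nab c y)) a x)) I
  + (k.+2)`!%:R / k`!%:R * alt (front (fun a => front (fun b J =>
      schouten (nab c) a b x * Ycomp (F nab c x) J))) I.
Proof.
move=> skF sF Ox; rewrite {1}/Zcomp scrD_expand //.
have kfact_neq0 : k`!%:R != 0 :> R by rewrite pnatr_eq0 -lt0n fact_gt0.
pose W a (J : {ffun 'I_k.+1 -> 'I_n}) := k.+1%:R * alt (front (fun b J =>
      schouten (nab c) a b x * Ycomp (F nab c x) J)) J.
have -> : (k.+2)`!%:R / k`!%:R * alt (front (fun a => front (fun b J =>
      schouten (nab c) a b x * Ycomp (F nab c x) J))) I = k.+2%:R * alt (front W) I.
  rewrite !factS !natrM mulrA mulfK // -mulrA; congr (_ * _).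
  by rewrite -alt_front_alt -altZ.
rewrite (alt_front_skew _ (V := fun a => cov (nab c) th (k.+1%:R + w)
      (fun y => Zcomp (F nab c y)) a x)); last first.
  move=> a; apply: (skew_cov _ _ _ _ (@chart_image_open _ _ M c)) Ox => [y Oy|J].
    exact/skew_Zcomp/skF.
  exact: sF.
rewrite alt_front_skew; last first.
  by move=> a s J; rewrite /W skew_alt mulrCA.
rewrite -big_split; apply: eq_bigr => i _ /=; rewrite -mulrDr; congr (_ * _).
rewrite ffunE tYS mulr0 mul0r add0r sum_tZ liftK.
have -> : [ffun j => lift_index I (lift i j)] = lift_index [ffun j => I (lift i j)].
  by apply/ffunP => j; rewrite !ffunE.
by rewrite -/(Zcomp _ _) /tractor_cov Zcomp_tractor_cov //; exact: skF.
Qed.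

End ColumnFormula.

(** * Weighted forms as components of tractor forms *)

Section WeightedForms.
Variables (R : realType) (n : nat) (M : smooth_manifold R n).

Lemma eq_weighted_form k w (xi xi' : form_field M n k) :
  (forall c x, chart_image c x -> xi c x =1 xi' c x) ->
  weighted_form w xi -> weighted_form w xi'.
Proof.
move=> e [sxi skxi trxi]; split.
- move=> c I; apply: smooth_eq (sxi c I); first exact: chart_image_open.
  by move=> x cx; exact: e.
- by move=> c x cx s I; rewrite -!e //; exact: skxi.
- move=> c c' x Ox I; rewrite -(e _ _ (overlap_sub Ox)) (trxi _ _ _ Ox); congr (_ * _).
  by apply: eq_pull; exact/e/transition_chart_image.
Qed.

Lemma density_factor_slots (c c' : atlas M) k w x : overlap c c' x ->
  density_factor (- w) (jac c c' x) * density_factor (- 1) (jac c c' x) ^+ k =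
  density_factor (- (k%:R + w)) (jac c c' x).
Proof.
move=> Ox; rewrite !density_factorE // -expRM_natl -expRD; congr expR; ring.
Qed.

Lemma weighted_form_Zcomp p nab k w (F : tractor_field M k) :
  p nab -> tractor_form p w F -> weighted_form (k%:R + w) (fun c x => Zcomp (F nab c x)).
Proof.
move=> pnab [sF skF trF _]; split.
- by move=> c I; exact: sF.
- by move=> c x cx; exact/skew_Zcomp/skF.
- move=> c c' x Ox I; rewrite /Zcomp (trF _ pnab _ _ _ Ox) pullZ mulrA density_factor_slots //.
  by congr (_ * _); exact: pull_lift0_Zcomp.
Qed.

Lemma weighted_form_Ycomp p nab k w (F : tractor_field M k.+1) :
  p nab -> tractor_form p w F -> weighted_form (k.+1%:R + w) (fun c x => Ycomp (F nab c x)).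
Proof.
move=> pnab [sF skF trF _]; split.
- by move=> c I; exact: sF.
- by move=> c x cx; exact/skew_Ycomp/skF.
- move=> c c' x Ox I; rewrite /Ycomp (trF _ pnab _ _ _ Ox) pullZ mulrA density_factor_slots //.
  by congr (_ * _); exact: pull_lift0_Ycomp.
Qed.

(** Smoothness, skewness and transition laws of the two entries are inherited from [F], so a column
    formula reduces to identifying [Ycomp] and [Zcomp] on chart images. *)
Lemma splits_as_components p nab k w (F : tractor_field M k.+1) (mu : form_field M n k)
    (xi : form_field M n k.+1) : p nab -> tractor_form p w F ->
  (forall c x, chart_image c x -> Ycomp (F nab c x) =1 mu c x) ->
  (forall c x, chart_image c x -> Zcomp (F nab c x) =1 xi c x) ->
  splits_as nab w F mu xi.
Proof.
move=> pnab tF Fmu Fxi.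
have wmu := eq_weighted_form Fmu (weighted_form_Ycomp pnab tF).
have wxi := eq_weighted_form Fxi (weighted_form_Zcomp pnab tF).
split=> // c x cx; have [_ skmu _] := wmu; have [_ skxi _] := wxi; have [_ skF _ _] := tF.
apply: skew_ext; first exact: skF.
- by apply: skew_column; [exact: skmu|exact: skxi].
- by move=> I; rewrite Ycomp_column ?Fmu //; exact: skmu.
- by move=> I; rewrite Zcomp_column ?Fxi //; exact: skmu.
Qed.

End WeightedForms.

Theorem proposition4p3 (R : realType) (n : nat) (M : smooth_manifold R n)
    (p : set (connection M)) (n_ge2 : (2 <= n)%N)
    (M_connected : connected [set: M]) (p_proj : projective_structure p) :
  (forall (k : nat) (w : R) (F : tractor_field M k),
     tractor_form p w F ->
     tractor_form p (w - 1) (scrD w F) /\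
     forall nab, p nab -> forall c x, chart_image c x -> forall A,
       scrD (w - 1) (scrD w F) nab c x A = 0)
  /\
  (forall (k : nat) (w : R) (F : tractor_field M k.+1) (nab : connection M)
          (mu : form_field M n k) (xi : form_field M n k.+1),
     p nab -> tractor_form p w F -> splits_as nab w F mu xi ->
     splits_as nab (w - 1) (scrD w F)
       (fun c x I => (w + k.+1%:R) * xi c x I
                     - k.+1%:R * alt_nabla nab (k.+1%:R + w) mu c x I)
       (fun c x I => k.+2%:R * alt_nabla nab (k.+1%:R + w) xi c x I
                     + (k.+2)`!%:R / k`!%:R * alt_schouten nab mu c x I)).
Proof.
split=> [k w F tF|k w F nab mu xi pnab tF [[_ skmu _] _ Fcol]].
  split; first exact: tractor_form_scrD.
  move=> nab pnab c x cx A; apply: scrD_scrD => //.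
  by case: tF => sF _ _ _ I; exact: sF.
have [sF skF _ _] := tF.
have sFc c : smooth_cotensor (chart_image c) (F nab c) by move=> I; exact: sF.
have Fmu c x : chart_image c x -> Ycomp (F nab c x) =1 mu c x.
  by move=> cx I; rewrite /Ycomp Fcol //; exact: Ycomp_column (skmu _ _ cx) _.
have Fxi c x : chart_image c x -> Zcomp (F nab c x) =1 xi c x.
  by move=> cx I; rewrite /Zcomp Fcol //; exact: Zcomp_column (skmu _ _ cx) _.
(* Invariance of [scrD F] settles the weights of both entries. The components of [F] sit under a
   covariant derivative, so their identification with [mu] and [xi] is used on the whole open chart
   image. *)
apply: (splits_as_components pnab (tractor_form_scrD n_ge2 tF)) => c x cx I.
- rewrite Ycomp_scrD //; last exact: skF.
  rewrite Fxi //; congr (_ - _ * _); apply: eq_alt; apply: eq_front => a.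
  exact: eq_cov (@chart_image_open _ _ M c) (Fmu c) cx.
- rewrite Zcomp_scrD //; last exact: skF.
  congr (_ * _ + _ * _); apply: eq_alt; apply: eq_front => a.
    exact: eq_cov (@chart_image_open _ _ M c) (Fxi c) cx.
  by apply: eq_front => b J; rewrite Fmu.
Qed.
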